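(* Let $k\in\mathbb{N}_+$. (1) If $\tilde w=t^{k(\alpha_1+2\alpha_2)}s_2s_1$, then $$f_{\tilde w,\mathbb{O}}=\begin{cases}(v-v^{-1})^2,&\mathbb{O}=\mathbb{O}_\lambda,\ \lambda\in Q_{(k-1)\alpha_1+(2k-2)\alpha_2},\\ v-v^{-1},&\mathbb{O}\in\mathbb{O}^{\leqslant}_{t^{k\alpha_1+(2k-1)\alpha_2}s_1}\cup\mathbb{O}'^{\leqslant}_{t^{(k-1)\alpha_1+(2k-2)\alpha_2}s_2},\\ 1,&\mathbb{O}=\mathbb{O}_2,\\ 0,&\text{otherwise.}\end{cases}$$ (2) If $\tilde w=t^{k(\alpha_1+2\alpha_2)}s_1s_2$, then $$f_{\tilde w,\mathbb{O}}=\begin{cases}(v-v^{-1})^2,&\mathbb{O}=\mathbb{O}_\lambda,\ \lambda\in Q_{k\alpha_1+2k\alpha_2},\\ v-v^{-1},&\mathbb{O}\in\mathbb{O}^{\leqslant}_{t^{k\alpha_1+(2k-1)\alpha_2}s_1}\cup\mathbb{O}'^{\leqslant}_{t^{k(\alpha_1+2\alpha_2)}s_2},\\ 1,&\mathbb{O}=\mathbb{O}_2,\\ 0,&\text{otherwise.}\end{cases}$$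
   Context: $W=\langle s_1,s_2\rangle$ is the finite Weyl group of type $A_2$; $\alpha_1,\alpha_2$ are the simple roots, identified with the simple coroots ($\langle\alpha_i,\alpha_i\rangle=2$, $\langle\alpha_1,\alpha_2\rangle=-1$); $Q=\mathbb{Z}\alpha_1\oplus\mathbb{Z}\alpha_2$; $P$ is the coweight lattice, $P_+$ its dominant elements; $\widetilde W=P\rtimes W$ with translations $t^\lambda$. $W_a=Q\rtimes W$ is the Coxeter group generated by $s_0=t^{\alpha_1+\alpha_2}s_1s_2s_1$, $s_1$, $s_2$; $\widetilde W=W_a\rtimes\langle\tau\rangle$ with $\tau^3=1$, $\tau s_0\tau^{-1}=s_1$, $\tau s_1\tau^{-1}=s_2$, $\tau s_2\tau^{-1}=s_0$; $\ell(w\tau^j)=\ell(w)$ for $w\in W_a$. $\mathbb{N}_+$ is the set of positive integers. Class polynomials: $\widetilde H$ is the algebra over $\mathbb{Z}[v,v^{-1}]$ with basis $T_{\tilde w}$ ($\tilde w\in\widetilde W$), $T_{\tilde x}T_{\tilde y}=T_{\tilde x\tilde y}$ if $\ell(\tilde x)+\ell(\tilde y)=\ell(\tilde x\tilde y)$, and $(T_s-v)(T_s+v^{-1})=0$ for $s\in\{s_0,s_1,s_2\}$. $[\widetilde H,\widetilde H]$ is the submodule spanned by commutators. For a conjugacy class $\mathbb{O}$ of $\widetilde W$, $\ell(\mathbb{O})$ is its minimal length and $T_{\mathbb{O}}$ is the image in $\widetilde H/[\widetilde H,\widetilde H]$ of $T_{w}$ for any minimal length $w\in\mathbb{O}$;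 by He–Nie this is well defined and the $T_{\mathbb{O}}$ form a basis. The class polynomials $f_{\tilde w,\mathbb{O}}$ are the unique coefficients with $T_{\tilde w}\equiv\sum_{\mathbb{O}}f_{\tilde w,\mathbb{O}}T_{\mathbb{O}}\bmod[\widetilde H,\widetilde H]$. Conjugacy classes of $\widetilde W$ in $W_a$: $\mathbb{O}_2=\{t^\lambda s_1s_2,\ t^\lambda s_2s_1\mid\lambda\in Q\}$; for $\lambda\in Q\cap P_+$, $\mathbb{O}_\lambda$ is the class of $t^\lambda$; for $i\in\mathbb{N}_+$, $\mathbb{C}_i=\{t^{k\alpha_1+i\alpha_2}s_1,\ t^{-i\alpha_1+k\alpha_2}s_2,\ t^{k\alpha_1+(k-i)\alpha_2}s_1s_2s_1\mid k\in\mathbb{Z}\}$, $\mathbb{C}'_i=\{t^{k\alpha_1-i\alpha_2}s_1,\ t^{i\alpha_1+k\alpha_2}s_2,\ t^{(k-i)\alpha_1+k\alpha_2}s_1s_2s_1\mid k\in\mathbb{Z}\}$. For $\lambda\in Q\cap P_+$: $\mathbb{O}^{\leqslant}_{t^\lambda s_1}$ is the set of all $\mathbb{C}_i$ ($i\in\mathbb{N}_+$) with $\ell(\mathbb{C}_i)\leq\ell$ of the conjugacy class of $t^\lambda s_1$; $\mathbb{O}'^{\leqslant}_{t^\lambda s_2}$ is the set of all $\mathbb{C}'_i$ with $\ell(\mathbb{C}'_i)\leq\ell$ of the conjugacy class of $t^\lambda s_2$. $Q_{sh}=Q\setminus\{k(\alpha_1+2\alpha_2),k(2\alpha_1+\alpha_2),k(\alpha_1-\alpha_2)\mid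 k\in\mathbb{Z}\}$; for $\alpha\in Q$, $Q_\alpha=\{\lambda\in Q\cap P_+\mid\lambda<\alpha\}\cap Q_{sh}$, where $\lambda<\alpha$ means $\alpha-\lambda$ is a nonzero combination of $\alpha_1,\alpha_2$ with nonnegative integer coefficients. *)

(* Defs.v *)
From HB Require Import structures.
From mathcomp Require Import all_boot all_order all_fingroup all_algebra.
From mathcomp Require Import boolp classical_sets cardinality fsbigop.
From mathcomp Require Import zify.

Set Implicit Arguments.
Unset Strict Implicit.
Unset Printing Implicit Defensive.

Import GRing.Theory.
Local Open Scope classical_set_scope.
Local Open Scope ring_scope.

(* The ring Z[v, v^-1], as the subring of Q(v) of the fractions p / v^n. *)
Definition laurent_pred : {pred {fraction {poly int}}} :=
  fun x => `[< exists (p : {poly int}) (n : nat),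
                 x = tofrac p / tofrac ('X ^+ n) >].

Lemma tofracXn_neq0 n : tofrac ('X ^+ n : {poly int}) != 0.
Proof. by rewrite tofrac_eq0 expf_neq0 // polyX_eq0. Qed.

Lemma laurent_pred_subring : subring_closed laurent_pred.
Proof.
split=> [|x y /asboolP[p [n ->]] /asboolP[q [m ->]]|
          x y /asboolP[p [n ->]] /asboolP[q [m ->]]]; apply/asboolP.
- by exists 1, 0%N; rewrite expr0 tofrac1 divr1.
- exists (p * 'X ^+ m - q * 'X ^+ n), (n + m)%N.
  rewrite -mulNr addf_div ?tofracXn_neq0 // exprD.
  by rewrite !(tofracM, tofracB, mulNr).
- exists (p * q), (n + m)%N.
  by rewrite mulf_div exprD !tofracM.
Qed.

Record laurent := Laurent {
  laurent_val :> {fraction {poly int}};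
  laurentP : laurent_val \in laurent_pred }.

HB.instance Definition _ := [isSub for laurent_val].
HB.instance Definition _ := [Choice of laurent by <:].
HB.instance Definition _ :=
  GRing.SubChoice_isSubComNzRing.Build {fraction {poly int}} laurent_pred
    laurent laurent_pred_subring.

Lemma laurent_v_proof : tofrac ('X : {poly int}) \in laurent_pred.
Proof. by apply/asboolP; exists 'X, 0%N; rewrite expr0 tofrac1 divr1. Qed.

Lemma laurent_vinv_proof : (tofrac ('X : {poly int}))^-1 \in laurent_pred.
Proof. by apply/asboolP; exists 1, 1%N; rewrite tofrac1 expr1 mul1r. Qed.

Definition v : laurent := Laurent laurent_v_proof.
Definition vinv : laurent := Laurent laurent_vinv_proof.

Lemma v_vinv : v * vinv = 1.
Proof.
apply: val_inj; rewrite rmorphM rmorph1 /=.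
by rewrite divff // tofrac_eq0 polyX_eq0.
Qed.

(* The coweight lattice P in the basis of fundamental coweights:             *)
(* (a, b) is the coweight with pairings <_, alpha1> = a and <_, alpha2> = b. *)
Notation coweight := (int * int)%type.

Definition alpha1 : coweight := (2, -1).
Definition alpha2 : coweight := (-1, 2).

Definition root_comb (a b : int) : coweight := alpha1 *~ a + alpha2 *~ b.

Definition rootQ : set coweight := [set x | exists a b, x = root_comb a b].

Definition dominant (x : coweight) : Prop := 0 <= x.1 /\ 0 <= x.2.

Definition o0 : 'I_3 := @Ordinal 3 0 isT.
Definition o1 : 'I_3 := @Ordinal 3 1 isT.
Definition o2 : 'I_3 := @Ordinal 3 2 isT.

(* The finite Weyl group is 'S_3. Write P as Z^3 / Z(1,1,1), with (a, b) the *)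
(* class of (a + b, b, 0); then w sends (x_i) to (x_(w i)). This is a left   *)
(* action because products in 'S_3 compose from left to right.               *)
Definition coord (x : coweight) (i : 'I_3) : int :=
  nth 0 [:: x.1 + x.2; x.2; 0] i.

Definition weyl_act (w : 'S_3) (x : coweight) : coweight :=
  (coord x (w o0) - coord x (w o1),
   coord x (w o1) - coord x (w o2)).

Lemma coord_diff x (i j : 'I_3) (w : 'S_3) :
  coord (weyl_act w x) i - coord (weyl_act w x) j = coord x (w i) - coord x (w j).
Proof.
have E k : coord (weyl_act w x) k = coord x (w k) - coord x (w o2).
  case: k => -[|[|[|//]]] lt_k.
  - by rewrite (_ : Ordinal lt_k = o0); [rewrite /coord /= addrA subrK | apply: val_inj].
  - by rewrite (_ : Ordinal lt_k = o1); [| apply: val_inj].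
  - by rewrite (_ : Ordinal lt_k = o2); [rewrite subrr | apply: val_inj].
by rewrite !E opprB addrA subrK.
Qed.

Lemma weyl_actM w1 w2 x : weyl_act (w1 * w2)%g x = weyl_act w1 (weyl_act w2 x).
Proof. by rewrite {1 2}/weyl_act !coord_diff !permM. Qed.

Lemma weyl_act1 x : weyl_act 1%g x = x.
Proof.
by case: x => a b; rewrite /weyl_act !perm1 /coord /= addrK subr0.
Qed.

Lemma weyl_actD w x y : weyl_act w (x + y) = weyl_act w x + weyl_act w y.
Proof.
have E i : coord (x + y) i = coord x i + coord y i.
  case: i => -[|[|[|//]]] ?; rewrite /coord /= ?addr0 //.
  by rewrite addrACA.
by rewrite /weyl_act !E !opprD; congr pair; rewrite addrACA.
Qed.

Lemma weyl_act0 w : weyl_act w 0 = 0.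
Proof. by apply: (addrI (weyl_act w 0)); rewrite -weyl_actD !addr0. Qed.

(* ExtW x w is t^x w. *)
Record extW := ExtW { trans : coweight; lin : 'S_3 }.

Definition extW_pair (u : extW) := (trans u, lin u).
Definition pair_extW (p : coweight * 'S_3) := ExtW p.1 p.2.
Lemma extW_pairK : cancel extW_pair pair_extW. Proof. by case. Qed.

HB.instance Definition _ := Choice.copy extW (can_type extW_pairK).

Definition extW_one := ExtW 0 1%g.
Definition extW_mul (u w : extW) :=
  ExtW (trans u + weyl_act (lin u) (trans w)) (lin u * lin w)%g.
Definition extW_inv (u : extW) :=
  ExtW (- weyl_act (lin u)^-1%g (trans u)) (lin u)^-1%g.

Lemma extW_mulA : associative extW_mul.
Proof.
move=> [x a] [y b] [z c]; rewrite /extW_mul /=.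
by rewrite weyl_actD weyl_actM addrA mulgA.
Qed.

Lemma extW_mul1 : left_id extW_one extW_mul.
Proof. by case=> x a; rewrite /extW_mul /= weyl_act1 add0r mul1g. Qed.

Lemma extW_mulr1 : right_id extW_one extW_mul.
Proof. by case=> x a; rewrite /extW_mul /= weyl_act0 addr0 mulg1. Qed.

Lemma extW_mulV : left_inverse extW_one extW_inv extW_mul.
Proof. by case=> x a; rewrite /extW_mul /= addNr mulVg. Qed.

Lemma extW_mulrV : right_inverse extW_one extW_inv extW_mul.
Proof.
case=> x a; rewrite /extW_mul /extW_one /= mulgV; congr ExtW.
apply: (addrI (weyl_act a (weyl_act a^-1%g x))).
by rewrite addrCA -weyl_actD subrr weyl_act0 addr0 -weyl_actM mulgV weyl_act1 addr0.
Qed.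

HB.instance Definition _ := isGroup.Build extW
  extW_mulA extW_mul1 extW_mulr1 extW_mulV extW_mulrV.

Definition t (x : coweight) : extW := ExtW x 1%g.
Definition s1 : extW := ExtW 0 (tperm o0 o1).
Definition s2 : extW := ExtW 0 (tperm o1 o2).
Definition s0 : extW := (t (alpha1 + alpha2) * s1 * s2 * s1)%g.

(* The translation part of tau is the first fundamental coweight. *)
Definition tau : extW := (t (1%R, 0%R) * s1 * s2)%g.

Definition simple (i : 'I_3) : extW := nth s0 [:: s0; s1; s2] i.

Lemma root_combE a b : root_comb a b = (a * 2 - b, b * 2 - a).
Proof.
have E (x : coweight) n : x *~ n = (x.1 * n, x.2 * n).
  by rewrite [LHS]surjective_pairing (raddfMz fst) (raddfMz snd) !mulrzz.
by rewrite /root_comb !E; congr pair => /=; lia.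
Qed.

Lemma weyl_act_s1 (x : coweight) : weyl_act (lin s1) x = x - root_comb x.1 0.
Proof.
case: x => a b; rewrite root_combE /weyl_act !permE /= /coord /=.
by congr pair => /=; lia.
Qed.

Lemma weyl_act_s2 (x : coweight) : weyl_act (lin s2) x = x - root_comb 0 x.2.
Proof.
case: x => a b; rewrite root_combE /weyl_act !permE /= /coord /=.
by congr pair => /=; lia.
Qed.

Lemma extW_eq (u w : extW) : trans u = trans w -> lin u =1 lin w -> u = w.
Proof. by case: u w => [x a] [y b] /= -> /permP->. Qed.

Lemma tau3 : (tau ^+ 3 = 1)%g.
Proof.
apply: extW_eq => [|[[|[|[|//]]] lt_i]].
  by rewrite /= /weyl_act !(permM, permE).
all: by apply: val_inj; rewrite /= !(permM, permE).
Qed.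

Lemma tau_s0 : (tau * s0 * tau^-1 = s1)%g.
Proof.
suff -> : (tau * s0 = s1 * tau)%g by rewrite mulgK.
apply: extW_eq => [|[[|[|[|//]]] lt_i]].
  by rewrite /= /weyl_act !(permM, permE).
all: by apply: val_inj; rewrite /= !(permM, permE).
Qed.

Lemma tau_s1 : (tau * s1 * tau^-1 = s2)%g.
Proof.
suff -> : (tau * s1 = s2 * tau)%g by rewrite mulgK.
apply: extW_eq => [|[[|[|[|//]]] lt_i]].
  by rewrite /= /weyl_act !(permM, permE).
all: by apply: val_inj; rewrite /= !(permM, permE).
Qed.

Lemma tau_s2 : (tau * s2 * tau^-1 = s0)%g.
Proof.
suff -> : (tau * s2 = s0 * tau)%g by rewrite mulgK.
apply: extW_eq => [|[[|[|[|//]]] lt_i]].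
  by rewrite /= /weyl_act !(permM, permE).
all: by apply: val_inj; rewrite /= !(permM, permE).
Qed.

Definition least (A : set nat) : nat :=
  xget 0%N [set n | A n /\ forall p, A p -> (n <= p)%N].

Definition word (s : seq 'I_3) : extW := (\prod_(i <- s) simple i)%g.

(* l (w tau^j) is the Coxeter length of w in W_a = <s0, s1, s2>; the class   *)
(* of j modulo 3 and the element w are determined by w tau^j.                *)
Definition extlen (u : extW) : nat :=
  least [set n | exists (s : seq 'I_3) (j : nat),
                   size s = n /\ u = (word s * tau ^+ j)%g].

Definition conj_class (u : extW) : set extW :=
  [set w | exists x : extW, w = (x * u * x^-1)%g].

Definition conj_classes : set (set extW) := range conj_class.

Definition class_len (O : set extW) : nat := least (extlen @` O).

Definition min_length_rep (m : set extW -> extW) : Prop :=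
  forall O, conj_classes O -> O (m O) /\ extlen (m O) = class_len O.

Definition is_basis (H : lmodType laurent) (T : extW -> H) : Prop :=
  forall h : H, exists! c : extW -> laurent,
    finite_set [set u | c u != 0] /\ h = \sum_(u \in setT) c u *: T u.

(* H with the family T is the Iwahori-Hecke algebra of the extended affine   *)
(* Weyl group.                                                               *)
Record is_hecke_algebra (H : algType laurent) (T : extW -> H) : Prop := {
  hecke_basis : is_basis T;
  hecke_mul : forall x y : extW,
    (extlen x + extlen y)%N = extlen (x * y)%g -> T x * T y = T (x * y)%g;
  hecke_quad : forall i : 'I_3,
    (T (simple i) - v%:A) * (T (simple i) + vinv%:A) = 0 }.

Definition commutator_span (H : algType laurent) : set H :=
  [set h | exists s : seq (laurent * (H * H)),
     h = \sum_(p <- s) p.1 *: (p.2.1 * p.2.2 - p.2.2 * p.2.1)].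

(* c lists the coefficients of T w, modulo commutators, on the family        *)
(* T_O = T (m O) indexed by the conjugacy classes O.                         *)
Definition cocenter_expansion (H : algType laurent) (T : extW -> H)
    (m : set extW -> extW) (w : extW) (c : set extW -> laurent) : Prop :=
  [/\ forall O, c O != 0 -> conj_classes O,
      finite_set [set O | c O != 0]
    & commutator_span
        (T w - \sum_(O \in conj_classes) c O *: T (m O))].

(* The default value 0 is only used if the unique expansion does not exist. *)
Definition class_poly (H : algType laurent) (T : extW -> H)
    (m : set extW -> extW) (w : extW) : set extW -> laurent :=
  xget (fun _ => 0) [set c | unique (cocenter_expansion T m w) c].

Definition class_O2 : set extW :=
  [set w | exists2 x, rootQ x & w = (t x * s1 * s2)%g \/ w = (t x * s2 * s1)%g].

Definition class_C (i : nat) : set extW :=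
  [set w | exists k : int,
     [\/ w = (t (root_comb k i%:Z) * s1)%g,
         w = (t (root_comb (- i%:Z) k) * s2)%g
       | w = (t (root_comb k (k - i%:Z)) * s1 * s2 * s1)%g]].

Definition class_C' (i : nat) : set extW :=
  [set w | exists k : int,
     [\/ w = (t (root_comb k (- i%:Z)) * s1)%g,
         w = (t (root_comb i%:Z k) * s2)%g
       | w = (t (root_comb (k - i%:Z) k) * s1 * s2 * s1)%g]].

Definition classes_C_le (x : coweight) : set (set extW) :=
  [set O | exists i : nat, [/\ (0 < i)%N, O = class_C i
     & (class_len O <= class_len (conj_class (t x * s1)%g))%N]].

Definition classes_C'_le (x : coweight) : set (set extW) :=
  [set O | exists i : nat, [/\ (0 < i)%N, O = class_C' i
     & (class_len O <= class_len (conj_class (t x * s2)%g))%N]].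

Definition Q_sh : set coweight :=
  rootQ `\` [set x | exists k : int,
    [\/ x = root_comb k (k * 2), x = root_comb (k * 2) k | x = root_comb k (- k)]].

Definition root_lt (x y : coweight) : Prop :=
  exists a b : nat, (a, b) != (0%N, 0%N) /\ y - x = root_comb a%:Z b%:Z.

Definition Q_below (a : coweight) : set coweight :=
  [set x | [/\ rootQ x, dominant x & root_lt x a]] `&` Q_sh.

Definition classes_below (a : coweight) : set (set extW) :=
  [set conj_class (t x) | x in Q_below a].

(* Main.v *)
(* Uniqueness of the coefficients: the images of the T_O in the cocenter are linearly
   independent because the algebra has enough trace functions. Their values at v = 1
   are characters of the group, which separate the conjugacy classes; a nontrivial
   relation could be divided by v - 1 until it survives at v = 1.

   Existence of the expansion: write q = v - v^-1 and w = alpha1 + 2 alpha2. If s is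
   simple and l(s u s) = l(u) - 2, then T_u = T_(s u s) + q T_(s u) modulo commutators.
   Applied along the chain
     t^((n+1) w) s1 s2 -> t^((n+1) w) s2 s1 -> ... -> t^(n w) s1 s2,
   this takes three such steps (two for n = 0). The elements s u of the last two steps
   have minimal length in C_(2n+1) and C_(2n). The one of the first step lies in
   C'_(n+1); it is not minimal and its own reduction produces exactly the T_(O_lambda)
   with lambda = (n+1) alpha1 + j alpha2 strictly dominant. *)
From HB Require Import structures.
Require Import Defs.
From mathcomp Require Import all_boot all_order all_fingroup all_algebra.
From mathcomp Require Import boolp classical_sets cardinality fsbigop.
From mathcomp Require Import zify ring.

Set Implicit Arguments.
Unset Strict Implicit.
Unset Printing Implicit Defensive.

Import GRing.Theory.
Local Open Scope classical_set_scope.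
Local Open Scope ring_scope.

(** * The length function *)

(** Independence has to hold for all conjugacy classes at once: a class polynomial is read off from
    an expansion that must be unique among all finitely supported ones. The obstacle is to obtain
    traces. A module that sees all translations has infinitely many weights, so its operators have
    no trace. Here the weights live in a finite ring, taken large enough for the finitely many
    classes of one relation; a trace is then a finite sum, and shifting weights before taking it
    singles out one weight. No module over [H] is built: Matsumoto's theorem attaches an operator to
    each group element, and the trace identities for simple reflections and [tau] pass to [H]
    through coordinates in the basis. For existence, the representatives [m O] are arbitrary
    elements of minimal length. The classes that occur therefore each need a proof that all their
    minimal length elements agree modulo commutators. *)

Variant weyl := We | W1 | W2 | W12 | W21 | W121.

Definition perm_of (w : weyl) : 'S_3 :=
  match w with
  | We => 1
  | W1 => lin s1
  | W2 => lin s2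
  | W12 => lin s1 * lin s2
  | W21 => lin s2 * lin s1
  | W121 => lin s1 * lin s2 * lin s1
  end%g.

(** With six named Weyl elements, identities in the group and comparisons of lengths become case
    analysis and linear arithmetic on two integers. *)
Definition el (a b : int) (w : weyl) : extW := ExtW (a, b) (perm_of w).

Definition weyl_mul (x y : weyl) : weyl :=
  match x, y with
  | We, _ => y
  | _, We => x
  | W1, W1 => We | W1, W2 => W12 | W1, W12 => W2 | W1, W21 => W121 | W1, W121 => W21
  | W2, W1 => W21 | W2, W2 => We | W2, W12 => W121 | W2, W21 => W1 | W2, W121 => W12
  | W12, W1 => W121 | W12, W2 => W1 | W12, W12 => W21 | W12, W21 => We | W12, W121 => W2
  | W21, W1 => W2 | W21, W2 => W121 | W21, W12 => We | W21, W21 => W12 | W21, W121 => W1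
  | W121, W1 => W12 | W121, W2 => W21 | W121, W12 => W1 | W121, W21 => W2 | W121, W121 => We
  end.

Definition act1 (w : weyl) (a b : int) : int :=
  match w with
  | We => a | W1 => - a | W2 => a + b | W12 => - a - b | W21 => b | W121 => - b
  end.

Definition act2 (w : weyl) (a b : int) : int :=
  match w with
  | We => b | W1 => a + b | W2 => - b | W12 => a | W21 => - a - b | W121 => - a
  end.

(* Iwahori-Matsumoto: the sum over the positive roots beta of
   |<x, beta> - [w^-1 beta < 0]|. *)
Definition len (a b : int) (w : weyl) : nat :=
  (match w with
   | We => absz a + absz b + absz (a + b)%R
   | W1 => absz (a - 1)%R + absz b + absz (a + b)%R
   | W2 => absz a + absz (b - 1)%R + absz (a + b)%R
   | W12 => absz (a - 1)%R + absz b + absz (a + b - 1)%R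
   | W21 => absz a + absz (b - 1)%R + absz (a + b - 1)%R
   | W121 => absz (a - 1)%R + absz (b - 1)%R + absz (a + b - 1)%R
   end)%N.

Lemma perm_ofM x y : perm_of (weyl_mul x y) = (perm_of x * perm_of y)%g.
Proof.
by case: x; case: y; apply/permP => -[[|[|[|//]]] ?]; apply: val_inj;
  rewrite /= !(permM, permE).
Qed.

Lemma perm_of_surj (p : 'S_3) : exists w, p = perm_of w.
Proof.
have E w : p o0 = perm_of w o0 -> p o1 = perm_of w o1 -> p o2 = perm_of w o2 ->
    exists w, p = perm_of w.
  move=> e0 e1 e2; exists w; apply/permP => -[[|[|[|//]]] lt_i].
  - by rewrite (_ : Ordinal lt_i = o0) //; apply: val_inj.
  - by rewrite (_ : Ordinal lt_i = o1) //; apply: val_inj.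
  - by rewrite (_ : Ordinal lt_i = o2) //; apply: val_inj.
have inj i j : i != j -> p i != p j by rewrite (inj_eq perm_inj).
have := (inj o0 o1 isT, inj o0 o2 isT, inj o1 o2 isT) => -[[d01 d02] d12].
have := (E We, E W1, E W2, E W12, E W21, E W121).
rewrite /= !permM !permE /= => -[[[[[H0 H1] H2] H3] H4] H5].
case: (p o0) (p o1) (p o2) d01 d02 d12 H0 H1 H2 H3 H4 H5 => -[|[|[|//]]] ? [[|[|[|//]]] ?]
  [[|[|[|//]]] ?] //= _ _ _ H0 H1 H2 H3 H4 H5;
  by [apply: H0; apply: val_inj | apply: H1; apply: val_inj | apply: H2; apply: val_inj
     | apply: H3; apply: val_inj | apply: H4; apply: val_inj | apply: H5; apply: val_inj].
Qed.

Lemma el_surj (u : extW) : exists a b w, u = el a b w.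
Proof.
case: u => -[a b] p; have [w ->] := perm_of_surj p.
by exists a, b, w.
Qed.

Lemma elM a b x c d y :
  (el a b x * el c d y)%g = el (a + act1 x c d) (b + act2 x c d) (weyl_mul x y).
Proof.
rewrite /el; rewrite [LHS]/(_ * _)%g /= /extW_mul /= perm_ofM; congr ExtW.
rewrite /weyl_act /=.
by case: x; congr pair => /=; rewrite !(permM, permE) /= /Defs.coord /=; lia.
Qed.

(* [mulgA] leaves [reverse_coercion] markers in its instances, which [lia] does
   not see through. *)
Lemma mulwA (x y z : extW) : (x * (y * z) = x * y * z)%g.
Proof. exact: mulgA. Qed.

Lemma el1 : (1 : extW)%g = el 0 0 We. Proof. by []. Qed.
Lemma s1E : s1 = el 0 0 W1. Proof. by []. Qed.
Lemma s2E : s2 = el 0 0 W2. Proof. by []. Qed.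
Lemma tE a b : t (a, b) = el a b We. Proof. by []. Qed.
Lemma s0E : s0 = el 1 1 W121.
Proof. by rewrite /s0 (tE (2 + -1) (-1 + 2)) s1E s2E !elM. Qed.
Lemma tauE : tau = el 1 0 W12.
Proof. by rewrite /tau tE s1E s2E !elM. Qed.

Lemma simpleE i : simple i =
  match val i with 0%N => el 1 1 W121 | 1%N => el 0 0 W1 | _ => el 0 0 W2 end.
Proof. by case: i => -[|[|[|//]]] ?; rewrite /simple /= ?s0E ?s1E ?s2E. Qed.

Definition ell (u : extW) : nat :=
  xget 0%N [set n | exists a b w, u = el a b w /\ n = len a b w].

Lemma perm_of_inj : injective perm_of.
Proof.
move=> x y /permP E; have := (E o0, E o1) => -[].
by case: x {E}; case: y; rewrite /= !(permM, permE).
Qed.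

Lemma el_inj a b w a' b' w' :
  el a b w = el a' b' w' -> [/\ a = a', b = b' & w = w'].
Proof. by case=> -> -> /perm_of_inj ->. Qed.

Lemma ellE a b w : ell (el a b w) = len a b w.
Proof.
rewrite /ell; case: xgetP => [n -> [a' [b' [w' [/el_inj[-> -> ->] ->]]]] //|].
by move=> /(_ (len a b w)) []; exists a, b, w.
Qed.

Lemma ell_tau u : ell (u * tau)%g = ell u.
Proof.
by have [a [b [w ->]]] := el_surj u; rewrite tauE elM !ellE; case: w => /=; lia.
Qed.

Lemma ell_tau_left u : ell (tau * u)%g = ell u.
Proof.
by have [a [b [w ->]]] := el_surj u; rewrite tauE elM !ellE; case: w => /=; lia.
Qed.

Lemma simple_ind (P : 'I_3 -> Prop) : P o0 -> P o1 -> P o2 -> forall i, P i.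
Proof.
move=> P0 P1 P2 [[|[|[|//]]] lt_i].
- by rewrite (_ : Ordinal lt_i = o0) //; apply: val_inj.
- by rewrite (_ : Ordinal lt_i = o1) //; apply: val_inj.
- by rewrite (_ : Ordinal lt_i = o2) //; apply: val_inj.
Qed.

Lemma ell_simple_left i u :
  ell (simple i * u)%g = (ell u).+1 \/ ell u = (ell (simple i * u)%g).+1.
Proof.
have [a [b [w ->]]] := el_surj u.
by elim/simple_ind: i; rewrite simpleE elM !ellE; case: w => /=; lia.
Qed.

Lemma ell_simple_right i u :
  ell (u * simple i)%g = (ell u).+1 \/ ell u = (ell (u * simple i)%g).+1.
Proof.
have [a [b [w ->]]] := el_surj u.
by elim/simple_ind: i; rewrite simpleE elM !ellE; case: w => /=; lia.
Qed.

Lemma simple_sqr i : (simple i * simple i = 1)%g.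
Proof. by elim/simple_ind: i; rewrite simpleE elM. Qed.

Lemma simpleK i u : (simple i * (simple i * u) = u)%g.
Proof. by rewrite mulwA simple_sqr mul1g. Qed.

Lemma simpleKr i u : (u * simple i * simple i = u)%g.
Proof. by rewrite -mulwA simple_sqr mulg1. Qed.

Lemma simple_braid i j : i != j ->
  (simple i * simple j * simple i = simple j * simple i * simple j)%g.
Proof.
by elim/simple_ind: i; elim/simple_ind: j => // _; rewrite !simpleE !elM.
Qed.

(** Any two distinct simple reflections generate a copy of S_3. Two left descents force its longest
    element, of length 3, to split off on the left. *)
Lemma ell_braid i j u : i != j ->
  (ell (simple i * u)%g < ell u)%N -> (ell (simple j * u)%g < ell u)%N ->
  ell u = (ell (simple i * (simple j * (simple i * u)))%g).+3.
Proof.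
have [a [b [w ->]]] := el_surj u.
by elim/simple_ind: i; elim/simple_ind: j => // _; rewrite !simpleE !elM !ellE;
  case: w => /=; lia.
Qed.

Lemma tau_pow j : (tau ^+ j = tau ^+ (j %% 3))%g.
Proof. by rewrite {1}(divn_eq j 3) expgD mulnC expgM tau3 expg1n mul1g. Qed.

Lemma ell0 u : ell u = 0%N -> exists j, u = (tau ^+ j)%g.
Proof.
have [a [b [w ->]]] := el_surj u; rewrite ellE.
case: w => /= len0; first by exists 0%N; have [-> ->] : a = 0 /\ b = 0 by lia.
all: try by exfalso; lia.
- have [-> ->] : a = 1 /\ b = 0 by lia.
  by exists 1%N; rewrite expg1 tauE.
- have [-> ->] : a = 0 /\ b = 1 by lia.
  by exists 2%N; rewrite expgS expg1 tauE elM.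
Qed.

Lemma ell_descent u n : ell u = n.+1 -> exists i, ell (simple i * u)%g = n.
Proof.
move=> lu; suff [i lt_i] : exists i, (ell (simple i * u)%g < ell u)%N.
  by exists i; have := ell_simple_left i u; lia.
case: (ltnP (ell (simple o0 * u)%g) (ell u)) => [|le0]; first by exists o0.
case: (ltnP (ell (simple o1 * u)%g) (ell u)) => [|le1]; first by exists o1.
case: (ltnP (ell (simple o2 * u)%g) (ell u)) => [|le2]; first by exists o2.
exfalso; move: lu le0 le1 le2; have [a [b [w ->]]] := el_surj u.
by rewrite !simpleE !elM !ellE; case: w => /=; lia.
Qed.

Lemma word_cons i s : (simple i * word s)%g = word (i :: s).
Proof. by rewrite /word big_cons. Qed.

Lemma ell_word s j : (ell (word s * tau ^+ j)%g <= size s)%N.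
Proof.
elim: s => [|i s IH]; last first.
  by rewrite -word_cons -mulwA /=; have := ell_simple_left i (word s * tau ^+ j)%g; lia.
rewrite /word big_nil mul1g; elim: j => [|j IH]; last by rewrite expgSr ell_tau.
by rewrite expg0 el1 ellE.
Qed.

Lemma reduced_word u : exists s j, size s = ell u /\ u = (word s * tau ^+ j)%g.
Proof.
move: {2}(ell u) (erefl (ell u)) => n; elim: n u => [|n IH] u lu.
  have [j ->] := ell0 lu; exists [::], j; rewrite /word big_nil mul1g; split=> //.
  by have := ell_word [::] j; rewrite /word big_nil mul1g /=; lia.
have [i li] := ell_descent lu; have [s [j [ss us]]] := IH _ li.
exists (i :: s), j; rewrite -word_cons -mulwA -us simpleK; split=> //=.
by rewrite ss li lu.
Qed.

Lemma leastE (A : set nat) n : A n -> (forall p, A p -> (n <= p)%N) -> least A = n.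
Proof.
move=> An leA; rewrite /least; case: xgetP => [p -> [Ap lep]|].
  by apply/eqP; rewrite eqn_leq lep //= leA.
by move=> /(_ n) [].
Qed.

(** A simple reflection changes [ell] by one and [tau] does not change it, so no word is shorter
    than [ell u]. Descents exist until [ell] is 0, which happens only on powers of [tau], so the
    bound is attained. *)
Lemma extlenE u : extlen u = ell u.
Proof.
apply: leastE => [|p [s [j [<- ->]]]]; last exact: ell_word.
by have [s [j [ss us]]] := reduced_word u; exists s, j.
Qed.

Lemma tau_expS j : (tau ^+ j.+1 = tau * tau ^+ j)%g.
Proof. exact: expgS. Qed.

Lemma tau_expSr j : (tau ^+ j.+1 = tau ^+ j * tau)%g.
Proof. exact: expgSr. Qed.

Lemma tau_simple i : (tau * simple i = simple (ordS i) * tau)%g.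
Proof. by elim/simple_ind: i; rewrite !simpleE tauE !elM. Qed.

Lemma tau_pow_simple j i :
  (tau ^+ j * simple i = simple (iter j (@ordS 3) i) * tau ^+ j)%g.
Proof.
elim: j i => [|j IH] i; first by rewrite !expg0 mul1g mulg1.
by rewrite tau_expSr -mulwA tau_simple mulwA IH -mulwA iterSr.
Qed.

Lemma tau_word s : (tau * word s = word (map (@ordS 3) s) * tau)%g.
Proof.
elim: s => [|i s IH]; first by rewrite /word big_nil mulg1 mul1g.
by rewrite -!word_cons mulwA tau_simple -mulwA IH mulwA.
Qed.

Lemma tau_pow_inj i j : (tau ^+ i = tau ^+ j)%g -> (i %% 3 = j %% 3)%N.
Proof.
rewrite tau_pow [RHS]tau_pow.
have E n : (n < 3)%N -> (tau ^+ n)%g = match n with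
    0%N => el 0 0 We | 1%N => el 1 0 W12 | _ => el 0 1 W21 end.
  by case: n => [|[|[|//]]] _; rewrite ?expg0 ?expgS ?expg0 ?mulg1 ?tauE ?elM.
have lt_i := ltn_pmod i (isT : 0 < 3)%N; have lt_j := ltn_pmod j (isT : 0 < 3)%N.
rewrite (E _ lt_i) (E _ lt_j).
by move: (i %% 3)%N (j %% 3)%N lt_i lt_j => [|[|[|//]]] [|[|[|//]]] _ _ // /el_inj[].
Qed.

(** * Matsumoto's theorem *)

Section Matsumoto.
Variables (X : Type) (R : 'I_3 -> X -> X) (Rt : X -> X).
Hypothesis R_braid : forall i j x, i != j -> R i (R j (R i x)) = R j (R i (R j x)).
Hypothesis Rt3 : forall x, Rt (Rt (Rt x)) = x.
Hypothesis Rt_R : forall i x, Rt (R i x) = R (ordS i) (Rt x).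

Let op (s : seq 'I_3) (x : X) := foldr R x s.

Lemma iter_Rt j x : iter j Rt x = iter (j %% 3) Rt x.
Proof.
rewrite {1}(divn_eq j 3) addnC iterD; congr iter.
by elim: (j %/ 3)%N => [//|n IH]; rewrite mulSn iterD /= IH Rt3.
Qed.

Lemma iter_Rt_R j i x : iter j Rt (R i x) = R (iter j (@ordS 3) i) (iter j Rt x).
Proof. by elim: j => [//|j IH] /=; rewrite IH Rt_R. Qed.

(** If the first letters differ, both are left descents, and [ell_braid] yields a common tail with a
    reduced word [r]. By induction each word may be replaced by one that starts with three
    alternating letters and continues with [r]; the braid relation then links the two. *)
Lemma op_unique n u s j s' j' x : ell u = n ->
  size s = ell u -> u = (word s * tau ^+ j)%g ->
  size s' = ell u -> u = (word s' * tau ^+ j')%g ->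
  op s (iter j Rt x) = op s' (iter j' Rt x).
Proof.
elim/ltn_ind: n u s j s' j' => -[|n] IH u s j s' j' lu ss us ss' us'.
  move: ss ss' us us'; rewrite lu => /size0nil-> /size0nil->.
  rewrite /word !big_nil !mul1g => -> /tau_pow_inj eq_j.
  by rewrite /= iter_Rt eq_j -iter_Rt.
case: s ss us => [|i s]; rewrite lu // => -[ss] us.
case: s' ss' us' => [|i' s']; rewrite lu // => -[ss'] us'.
have red k r l : size r = n -> u = (word (k :: r) * tau ^+ l)%g ->
    (simple k * u)%g = (word r * tau ^+ l)%g /\ ell (simple k * u)%g = n.
  move=> sr ur; have E : (simple k * u)%g = (word r * tau ^+ l)%g.
    by rewrite ur -word_cons -mulwA simpleK.
  split=> //; have := ell_word r l; rewrite -E sr.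
  by have := ell_simple_left k u; lia.
have [us1 ls1] := red _ _ _ ss us; have [us2 ls2] := red _ _ _ ss' us'.
have [eq_i|ne_i] := eqVneq i i'.
  rewrite /= -eq_i; congr R.
  by apply: (IH n _ (simple i * u)%g) => //; rewrite ?ls1 // eq_i.
have lb : ell u = (ell (simple i * (simple i' * (simple i * u)))%g).+3.
  by apply: ell_braid => //; lia.
have [r [l [sr ur]]] := reduced_word (simple i * (simple i' * (simple i * u)))%g.
have -> : op (i :: s) (iter j Rt x) = op (i :: i' :: i :: r) (iter l Rt x).
  rewrite /=; congr R.
  apply: (IH n _ (simple i * u)%g s j [:: i', i & r] l) => //=; rewrite ?ls1 //; try lia.
  by rewrite -!word_cons -!mulwA -ur !simpleK.
have -> : op (i' :: s') (iter j' Rt x) = op (i' :: i :: i' :: r) (iter l Rt x).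
  rewrite /=; congr R.
  apply: (IH n _ (simple i' * u)%g s' j' [:: i, i' & r] l) => //=; rewrite ?ls2 //; try lia.
  rewrite -!word_cons -!mulwA -ur; move: (simple_braid ne_i) => B.
  by rewrite !mulwA B -!mulwA !simpleK.
exact: R_braid.
Qed.

Definition rho (u : extW) : X -> X :=
  let: exist s H := cid (reduced_word u) in
  let: exist j _ := cid H in fun x => op s (iter j Rt x).

Lemma rhoE u s j x : size s = ell u -> u = (word s * tau ^+ j)%g ->
  rho u x = op s (iter j Rt x).
Proof.
move=> ss us; rewrite /rho; case: cid => s' H; case: cid => j' [ss' us'].
exact: (@op_unique (ell u) u).
Qed.

Lemma rho_simple i u x : ell (simple i * u)%g = (ell u).+1 ->
  rho (simple i * u)%g x = R i (rho u x).
Proof.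
move=> lu; have [s [j [ss us]]] := reduced_word u.
rewrite (rhoE x ss us) (@rhoE _ (i :: s) j) //= ?lu ?ss //.
by rewrite -word_cons -mulwA -us.
Qed.

Lemma rho_tau_right u x : rho (u * tau)%g x = rho u (Rt x).
Proof.
have [s [j [ss us]]] := reduced_word u.
rewrite (rhoE _ ss us) (@rhoE _ s j.+1) ?ell_tau //; first by rewrite iterSr.
by rewrite {1}us tau_expSr -mulwA.
Qed.

Lemma rho_tau_left u x : rho (tau * u)%g x = Rt (rho u x).
Proof.
have [s [j [ss us]]] := reduced_word u.
rewrite (rhoE _ ss us) (@rhoE _ (map (@ordS 3) s) j.+1).
- rewrite /=; elim: s {ss us} => [//|i s IH] /=.
  by rewrite Rt_R IH.
- by rewrite size_map ell_tau_left.
by rewrite {1}us (mulwA tau (word s)) tau_word tau_expS -mulwA.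
Qed.

(** Reduced words are only peeled from the left. A left descent [k] of [u] remains one of
    [u * simple i] because the latter is longer than [u], so the induction can strip [k] from
    both. *)
Lemma rho_simple_right i u x : ell (u * simple i)%g = (ell u).+1 ->
  rho (u * simple i)%g x = rho u (R i x).
Proof.
move: {2}(ell u) (erefl (ell u)) => n; elim: n u => [|n IH] u lu lui.
  have [j uj] := ell0 lu; rewrite uj in lu lui *; rewrite tau_pow_simple.
  rewrite (@rhoE _ [:: iter j (@ordS 3) i] j); first last.
  - by rewrite -word_cons /word big_nil mulg1.
  - by rewrite -tau_pow_simple lui lu.
  by rewrite (@rhoE _ [::] j) /= ?lu ?iter_Rt_R // /word big_nil mul1g.
have [k lk] := ell_descent lu; have E : u = (simple k * (simple k * u))%g by rewrite simpleK.
have l1 : ell (simple k * u * simple i)%g = n.+1.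
  have := ell_simple_left k (simple k * u * simple i)%g.
  by have := ell_simple_right i (simple k * u)%g; rewrite -mulwA simpleK; lia.
rewrite {1}E -mulwA rho_simple ?IH ?lk //; last by rewrite mulwA -E lui l1 lu.
by rewrite -rho_simple -?E // lk lu.
Qed.

End Matsumoto.

(** * Representations on words *)

Definition vq : laurent := v - vinv.

Section Representation.
Variables (U : finComNzRingType) (u : 'I_3 -> U) (kap : U).
Hypothesis kap3 : kap *+ 3 = 0.

Local Notation pt := ('I_3 * 'I_3 * 'I_3 * U)%type.
Local Notation fn := {ffun pt -> laurent}.

(** A right action, so that functions carry a left one. The coefficients of [u x], [u y], [u z] are
    three times the trace-free coordinates of the coweight; the factor 3 makes them integral on all
    of P. They cancel on constant words, where only the term in [kap] remains and records the class
    in P/Q. *)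
Definition act (p : pt) (a b : int) (w : weyl) : pt :=
  let: (x, y, z, k) := p in
  (match w with
   | We => (x, y, z) | W1 => (y, x, z) | W2 => (x, z, y)
   | W12 => (y, z, x) | W21 => (z, x, y) | W121 => (z, y, x) end,
   k + ((2 * a + b)%:~R * u x + (b - a)%:~R * u y - (a + 2 * b)%:~R * u z)
     + kap *~ (a - b)).

Lemma kap_mod a b n : a - b = 3 * n -> kap *~ a = kap *~ b.
Proof.
move=> E; have -> : a = b + 3 * n by lia.
by rewrite mulrzDr mulrzA -[kap *~ 3]/(kap *+ 3) kap3 mul0rz addr0.
Qed.

Lemma actM p a b x c d y :
  act (act p a b x) c d y =
  act p (a + act1 x c d) (b + act2 x c d) (weyl_mul x y).
Proof.
have K : kap *~ (a + act1 x c d - (b + act2 x c d)) =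
          kap *~ (a - b) + kap *~ (c - d).
  rewrite -mulrzDr; case: x => /=;
   [apply: (kap_mod (n := 0)) | apply: (kap_mod (n := - c)) | apply: (kap_mod (n := d))
   |apply: (kap_mod (n := - c)) | apply: (kap_mod (n := d)) | apply: (kap_mod (n := 0))]; lia.
case: p => [[[p0 p1] p2] k]; rewrite /act K; case: x {K};
  (congr pair; try by [case: y]); rewrite /act1 /act2; ring.
Qed.

Arguments act : simpl never.

Definition ptS (i : 'I_3) (p : pt) : pt :=
  match val i with
  | 0%N => act p 1 1 W121 | 1%N => act p 0 0 W1 | _ => act p 0 0 W2 end.

Definition ptT (p : pt) : pt := act p 1 0 W12.

Definition let1 (i : 'I_3) (p : pt) : 'I_3 :=
  let: (x, y, z, k) := p in match val i with 0%N => z | 1%N => x | _ => y end.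

Definition let2 (i : 'I_3) (p : pt) : 'I_3 :=
  let: (x, y, z, k) := p in match val i with 0%N => x | 1%N => y | _ => z end.

(* Words of three letters, with a weight in U: T_s swaps the two letters that it
   compares, as on the third tensor power of the vector representation. Words with
   letters 012, 001 and 000 span representations induced from the torus, from a
   Levi subgroup with one simple root, and from the whole group. *)
Definition opR (i : 'I_3) (phi : fn) : fn :=
  [ffun p => if let1 i p == let2 i p then v * phi p
             else phi (ptS i p) + (let2 i p < let1 i p)%N%:R * (vq * phi p)].

Definition opT (phi : fn) : fn := [ffun p => phi (ptT p)].

Lemma act0 p : act p 0 0 We = p.
Proof. by case: p => [[[x y] z] k]; rewrite /act; congr pair; ring. Qed.

Lemma opT3 phi : opT (opT (opT phi)) = phi.
Proof. by apply/ffunP => p; rewrite !ffunE /ptT !actM act0. Qed.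

Lemma opT_R i phi : opT (opR i phi) = opR (ordS i) (opT phi).
Proof.
apply/ffunP => p; rewrite !ffunE.
have -> : let1 i (ptT p) = let1 (ordS i) p.
  by case: p => [[[x y] z] k]; elim/simple_ind: i.
have -> : let2 i (ptT p) = let2 (ordS i) p.
  by case: p => [[[x y] z] k]; elim/simple_ind: i.
have -> // : ptS i (ptT p) = ptT (ptS (ordS i) p).
by elim/simple_ind: i; rewrite /ptS /ptT !actM /=; congr act; ring.
Qed.

Lemma vq_sqr : v * v = 1 + vq * v.
Proof. by rewrite /vq mulrBl [vinv * v]mulrC v_vinv addrC subrK. Qed.

Lemma opT_surj phi : exists psi, phi = opT psi.
Proof. by exists (opT (opT phi)); rewrite opT3. Qed.

(** Conjugation by [opT] rotates the three operators, so a relation has to be computed only where no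
    weight moves, away from the affine reflection. *)
Lemma ordS_ind (P : 'I_3 -> Prop) :
  (forall i, P i -> P (ordS i)) -> P o1 -> forall i, P i.
Proof.
have E2 : ordS o1 = o2 by apply: val_inj.
have E0 : ordS o2 = o0 by apply: val_inj.
move=> PS P1; have P2 : P o2 by rewrite -E2; apply: PS.
have P0 : P o0 by rewrite -E0; apply: PS.
by elim/simple_ind.
Qed.

Lemma ptS1 x y z k : ptS o1 (x, y, z, k) = (y, x, z, k).
Proof. by rewrite /ptS /act /=; congr pair; ring. Qed.

Lemma ptS2 x y z k : ptS o2 (x, y, z, k) = (x, z, y, k).
Proof. by rewrite /ptS /act /=; congr pair; ring. Qed.

Definition comb (a : laurent) (phi psi : fn) : fn := [ffun p => a * phi p + psi p].

Lemma opR_quad i phi : opR i (opR i phi) = comb vq (opR i phi) phi.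
Proof.
elim/ordS_ind: i phi => [i IH phi|phi].
  have [psi ->] := opT_surj phi; rewrite -!opT_R IH; apply/ffunP => p.
  by rewrite !ffunE.
apply/ffunP => -[[[x y] z] k].
have E : ptS o1 (ptS o1 (x, y, z, k)) = (x, y, z, k) by rewrite (ptS1 x) ptS1.
rewrite [RHS]ffunE [LHS]ffunE ![opR o1 phi _]ffunE E.
rewrite /let1 /let2 /= [y == x]eq_sym.
case: eqVneq => [_|ne]; first by rewrite !mulrA vq_sqr; ring.
have /orP : (x < y)%N || (y < x)%N by rewrite -neq_ltn.
by case=> lt; rewrite lt (leq_gtF (ltnW lt)) /=; ring.
Qed.

Lemma opR_braid i j phi : i != j ->
  opR i (opR j (opR i phi)) = opR j (opR i (opR j phi)).
Proof.
have B phi' : opR o1 (opR o2 (opR o1 phi')) = opR o2 (opR o1 (opR o2 phi')).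
{ apply/ffunP => -[[[x y] z] k].
  rewrite !ffunE !(ptS1 x y z) !(ptS2 x y z) !(ptS2 y x z) !(ptS1 x z y).
  rewrite !(ptS1 y z x) !(ptS2 z x y) !(ptS2 x z y) !(ptS1 y x z) /let1 /let2 /=.
  have tri (a b : 'I_3) : [\/ a = b,
      [/\ (a < b)%N, (b < a)%N = false, (a == b) = false & (b == a) = false]
    | [/\ (b < a)%N, (a < b)%N = false, (a == b) = false & (b == a) = false]].
    have [->|ne] := eqVneq a b; first by constructor 1.
    have /orP[lt|lt] : (a < b)%N || (b < a)%N by rewrite -neq_ltn.
    - have ne' : b != a by rewrite eq_sym.
      by constructor 2; split; rewrite ?(leq_gtF (ltnW lt)) ?(negPf ne) ?(negPf ne').
    - have ne' : b != a by rewrite eq_sym.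
      by constructor 3; split; rewrite ?(leq_gtF (ltnW lt)) ?(negPf ne) ?(negPf ne').
  case: (tri x y) => [E1|[l1 g1 e1 f1]|[l1 g1 e1 f1]];
  case: (tri y z) => [E2|[l2 g2 e2 f2]|[l2 g2 e2 f2]];
  case: (tri x z) => [E3|[l3 g3 e3 f3]|[l3 g3 e3 f3]];
  subst; try (by exfalso; lia).
  all: rewrite ?eqxx ?l1 ?g1 ?e1 ?f1 ?l2 ?g2 ?e2 ?f2 ?l3 ?g3 ?e3 ?f3 ?ltnn /=.
  all: ring: vq_sqr. }
have shift (a b : 'I_3) :
    (forall psi, opR a (opR b (opR a psi)) = opR b (opR a (opR b psi))) ->
    forall psi, opR (ordS a) (opR (ordS b) (opR (ordS a) psi))
              = opR (ordS b) (opR (ordS a) (opR (ordS b) psi)).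
  by move=> H psi; have [chi ->] := opT_surj psi; rewrite -!opT_R H.
have E2 : ordS o1 = o2 by apply: val_inj.
have E0 : ordS o2 = o0 by apply: val_inj.
have E1 : ordS o0 = o1 by apply: val_inj.
have B2 := shift _ _ B; rewrite E2 E0 in B2.
have B3 := shift _ _ B2; rewrite E1 E0 in B3.
by elim/simple_ind: i; elim/simple_ind: j.
Qed.

Definition lin (F : fn -> fn) : Prop :=
  forall a phi psi, F (comb a phi psi) = comb a (F phi) (F psi).

Lemma lin_comp F G : lin F -> lin G -> lin (F \o G).
Proof. by move=> lF lG a phi psi /=; rewrite lG lF. Qed.

Lemma lin_opR i : lin (opR i).
Proof.
by move=> a phi psi; apply/ffunP => p; rewrite !ffunE; case: eqP => _; ring.
Qed.

Lemma lin_opT : lin opT.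
Proof. by move=> a phi psi; apply/ffunP => p; rewrite !ffunE. Qed.

Definition dl (p : pt) : fn := [ffun q => (q == p)%:R].

Lemma fn_expand F phi p : lin F -> F phi p = \sum_q phi q * F (dl q) p.
Proof.
move=> lF.
have F0 : F [ffun=> 0] p = 0.
  have := lF (-1) [ffun=> 0] [ffun=> 0].
  have -> : comb (-1) [ffun=> 0] [ffun=> 0] = [ffun=> 0].
    by apply/ffunP => q; rewrite !ffunE; ring.
  by move=> /(congr1 (fun f : fn => f p)); rewrite ffunE => ->; ring.
have E (s : seq pt) (c : pt -> laurent) :
    F [ffun r => \sum_(q <- s) c q * dl q r] p = \sum_(q <- s) c q * F (dl q) p.
  elim: s => [|q s IH].
    by rewrite big_nil -F0; congr (F _ p); apply/ffunP => r; rewrite !ffunE big_nil.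
  rewrite big_cons -IH.
  have -> : [ffun r => \sum_(q <- q :: s) c q * dl q r] =
      comb (c q) (dl q) [ffun r => \sum_(q <- s) c q * dl q r].
    by apply/ffunP => r; rewrite !ffunE big_cons ffunE.
  by rewrite lF ffunE.
rewrite -E; congr (F _ p); apply/ffunP => r; rewrite ffunE (bigD1 r) //= big1 => [|q ne].
  by rewrite !ffunE eqxx mulr1 addr0.
by rewrite ffunE eq_sym (negPf ne) mulr0.
Qed.

Definition tr (F : fn -> fn) : laurent := \sum_p F (dl p) p.

Lemma trC F G : lin F -> lin G -> tr (F \o G) = tr (G \o F).
Proof.
move=> lF lG; rewrite /tr /=.
under eq_bigr do rewrite (fn_expand _ _ lF).
under [RHS]eq_bigr do rewrite (fn_expand _ _ lG).
by rewrite exchange_big; apply: eq_bigr => p _; apply: eq_bigr => q _; rewrite mulrC.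
Qed.

Local Notation rho := (rho opR opT).

Lemma lin_rho w : lin (rho w).
Proof.
have [s [j [ss us]]] := reduced_word w; move=> a phi psi.
rewrite !(rhoE opR_braid opT3 _ ss us).
have -> : iter j opT (comb a phi psi) = comb a (iter j opT phi) (iter j opT psi).
  by elim: j {us} => [//|j /= ->]; rewrite lin_opT.
by elim: s {ss us} => [//|i s /= ->]; rewrite lin_opR.
Qed.

Section Trace.
Variables (P : 'I_3 -> 'I_3 -> 'I_3 -> bool) (nu : U).
Hypothesis P12 : forall x y z, P y x z = P x y z.
Hypothesis P23 : forall x y z, P x z y = P x y z.

(* This operator commutes with the action, so composing with it before taking
   the trace gives a trace function on the algebra. *)
Definition opD (phi : fn) : fn :=
  [ffun p => let: (x, y, z, k) := p in if P x y z then phi (x, y, z, k - nu) else 0].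

Lemma lin_opD : lin opD.
Proof.
move=> a phi psi; apply/ffunP => -[[[x y] z] k]; rewrite !ffunE.
by case: (P x y z); rewrite ?ffunE //; ring.
Qed.

Lemma opD_act phi x y z k a b w :
  opD phi (act (x, y, z, k) a b w) =
  if P x y z then phi (act (x, y, z, k - nu) a b w) else 0.
Proof.
rewrite /act ffunE.
have [P1 P2 P3 P4 P5] : [/\ P y x z = P x y z, P x z y = P x y z,
   P y z x = P x y z, P z x y = P x y z & P z y x = P x y z].
  have P4 : P y z x = P x y z by rewrite P23 P12.
  have P5 : P z x y = P x y z by rewrite P12 P23.
  by split=> //; rewrite P12 P4.
by case: w; rewrite ?(P1, P2, P3, P4, P5); case: (P x y z) => //;
   congr (phi (_, _)); ring.
Qed.

Lemma opD_opT phi : opD (opT phi) = opT (opD phi).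
Proof.
apply/ffunP => -[[[x y] z] k]; rewrite [RHS]ffunE /ptT opD_act [LHS]ffunE.
by case: (P x y z); rewrite ?ffunE.
Qed.

Lemma opD_opR i phi : opD (opR i phi) = opR i (opD phi).
Proof.
apply/ffunP => -[[[x y] z] k]; rewrite [RHS]ffunE.
have -> : opD phi (ptS i (x, y, z, k)) = if P x y z then phi (ptS i (x, y, z, k - nu)) else 0.
  by elim/simple_ind: i; rewrite /ptS /= opD_act.
rewrite [LHS]ffunE [opD phi _]ffunE; case: (P x y z); last first.
  by case: eqP => _; ring.
by rewrite ffunE; elim/simple_ind: i.
Qed.

Definition trace (w : extW) : laurent := tr (rho w \o opD).

Lemma tr_comb a F G H : (forall phi, F phi = comb a (G phi) (H phi)) ->
  tr F = a * tr G + tr H.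
Proof.
move=> E; rewrite /tr mulr_sumr -big_split; apply: eq_bigr => p _.
by rewrite E ffunE.
Qed.

Lemma trace_left i w : tr (opR i \o (rho w \o opD)) =
  trace (simple i * w)%g + (if (ell (simple i * w)%g < ell w)%N then vq * trace w else 0).
Proof.
case: (ell_simple_left i w) => E.
  rewrite E ltnNge leqnSn /= addr0; apply: eq_bigr => p _ /=.
  by rewrite (rho_simple opR_braid opT3).
rewrite E ltnSn addrC; apply: tr_comb => phi /=.
have E' : ell (simple i * (simple i * w))%g = (ell (simple i * w)%g).+1.
  by rewrite simpleK.
have := rho_simple opR_braid opT3 (opD phi) E'; rewrite simpleK => ->.
exact: opR_quad.
Qed.

Lemma trace_right i w : tr (rho w \o (opD \o opR i)) =
  trace (w * simple i)%g + (if (ell (w * simple i)%g < ell w)%N then vq * trace w else 0).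
Proof.
case: (ell_simple_right i w) => E.
  rewrite E ltnNge leqnSn /= addr0; apply: eq_bigr => p _ /=.
  by rewrite (rho_simple_right opR_braid opT3 opT_R) // opD_opR.
rewrite E ltnSn addrC; apply: tr_comb => phi /=.
have E' : ell (w * simple i * simple i)%g = (ell (w * simple i)%g).+1.
  by rewrite simpleKr.
rewrite opD_opR.
have := rho_simple_right opR_braid opT3 opT_R (opD phi) E'; rewrite simpleKr => ->.
have := rho_simple_right opR_braid opT3 opT_R (opR i (opD phi)) E'; rewrite simpleKr => ->.
by rewrite opR_quad lin_rho.
Qed.

Lemma trace_simple i w :
  trace (simple i * w)%g + (if (ell (simple i * w)%g < ell w)%N then vq * trace w else 0) =
  trace (w * simple i)%g + (if (ell (w * simple i)%g < ell w)%N then vq * trace w else 0).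
Proof.
rewrite -trace_left -trace_right trC //; first exact: lin_opR.
exact: lin_comp (lin_rho _) lin_opD.
Qed.

Lemma trace_tau w : trace (tau * w)%g = trace (w * tau)%g.
Proof.
have E : trace (tau * w)%g = tr (opT \o (rho w \o opD)).
  by apply: eq_bigr => p _ /=; rewrite (rho_tau_left opR_braid opT3 opT_R).
rewrite E trC; [|exact: lin_opT|exact: lin_comp (lin_rho _) lin_opD].
apply: eq_bigr => p _ /=.
by rewrite (rho_tau_right opR_braid opT3) opD_opT.
Qed.

End Trace.
End Representation.

(** * Specialization at v = 1 *)

Lemma laurent_frac (x : laurent) :
  exists pn : {poly int} * nat, val x = tofrac pn.1 / tofrac ('X ^+ pn.2).
Proof. by have /asboolP[p [n E]] := laurentP x; exists (p, n). Qed.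

(** The value at v = 1. The chosen numerator does not matter, as the denominators ['X ^+ n] take the
    value 1 there. *)
Definition ev (x : laurent) : int := (sval (cid (laurent_frac x))).1.[1].

Lemma evE (x : laurent) p n : val x = tofrac p / tofrac ('X ^+ n) -> ev x = p.[1].
Proof.
rewrite /ev; case: cid => -[q m] /= -> /eqP.
rewrite eqr_div ?tofracXn_neq0 // -!tofracM tofrac_eq => /eqP /(congr1 (horner^~ 1)).
by rewrite !hornerE !expr1n !mulr1.
Qed.

Lemma ev0 : ev 0 = 0.
Proof. by rewrite (@evE 0 0 0) ?horner0 // tofrac0 mul0r. Qed.

Lemma ev1 : ev 1 = 1.
Proof.
by rewrite (@evE 1 1 0); [rewrite hornerE | rewrite expr0 tofrac1 divr1].
Qed.

Lemma evD x y : ev (x + y) = ev x + ev y.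
Proof.
have [[p n] /= Ex] := laurent_frac x; have [[q m] /= Ey] := laurent_frac y.
rewrite (evE Ex) (evE Ey) (@evE _ (p * 'X ^+ m + q * 'X ^+ n) (n + m)).
  by rewrite !hornerE !expr1n !mulr1.
rewrite rmorphD /= Ex Ey addf_div ?tofracXn_neq0 // exprD.
by rewrite !(tofracM, tofracD).
Qed.

Lemma evM x y : ev (x * y) = ev x * ev y.
Proof.
have [[p n] /= Ex] := laurent_frac x; have [[q m] /= Ey] := laurent_frac y.
rewrite (evE Ex) (evE Ey) (@evE _ (p * q) (n + m)) ?hornerE //.
by rewrite rmorphM /= Ex Ey mulf_div exprD !tofracM.
Qed.

Lemma ev_v : ev v = 1.
Proof.
by rewrite (@evE _ 'X 0); [rewrite hornerX | rewrite expr0 tofrac1 divr1].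
Qed.

Lemma ev_vq : ev vq = 0.
Proof.
have : ev (v * vinv) = 1 by rewrite v_vinv ev1.
have : ev (vq + vinv) = 1 by rewrite /vq subrK ev_v.
by rewrite evM ev_v mul1r evD => H1 H2; lia.
Qed.

Lemma ev_sum (I : Type) (r : seq I) (P : pred I) (F : I -> laurent) :
  ev (\sum_(i <- r | P i) F i) = \sum_(i <- r | P i) ev (F i).
Proof. exact: (big_morph ev evD ev0). Qed.

Lemma ev_bool (b : bool) : ev b%:R = b%:R.
Proof. by case: b; rewrite ?ev0 ?ev1. Qed.

Section AtOne.
Variables (U : finComNzRingType) (u : 'I_3 -> U) (kap : U).
Hypothesis kap3 : kap *+ 3 = 0.

Local Notation pt := ('I_3 * 'I_3 * 'I_3 * U)%type.
Local Notation fn := {ffun pt -> laurent}.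
Local Notation act := (act u kap).
Local Notation rho := (rho (opR u kap) (opT u kap)).

Lemma ptS_eq i p : let1 i p == let2 i p -> ptS u kap i p = p.
Proof.
case: p => [[[x y] z] k]; elim/simple_ind: i => /= /eqP->;
  by rewrite /ptS /act /=; congr (_, _); ring.
Qed.

Lemma ev_opR i (phi : fn) p : ev (opR u kap i phi p) = ev (phi (ptS u kap i p)).
Proof.
rewrite ffunE; case: ifP => E; first by rewrite evM ev_v mul1r ptS_eq.
by rewrite evD !evM ev_vq mul0r mulr0 addr0.
Qed.

Lemma ev_rho a b x (phi : fn) p :
  ev (rho (el a b x) phi p) = ev (phi (act p a b x)).
Proof.
have [s [j [ss us]]] := reduced_word (el a b x).
rewrite (rhoE (opR_braid u kap3) (opT3 u kap3) _ ss us) {ss}.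
elim: s a b x p us => [|i s IH] a b x p us /=.
  rewrite /word big_nil mul1g in us.
  elim: j a b x p us => [|j IH] a b x p us.
    by move: us; rewrite expg0 el1 => /el_inj[-> -> ->]; rewrite act0.
  rewrite /= ffunE; have [a' [b' [x' E]]] := el_surj (tau ^+ j)%g.
  rewrite (IH _ _ _ _ (esym E)) /ptT (actM u kap3); move: us.
  by rewrite tau_expS E tauE elM => /el_inj[-> -> ->].
rewrite ev_opR; have [a' [b' [x' E]]] := el_surj (word s * tau ^+ j)%g.
rewrite (IH _ _ _ _ (esym E)); move: us; rewrite -word_cons -mulwA E.
by elim/simple_ind: i; rewrite simpleE elM /ptS (actM u kap3) => /el_inj[-> -> ->].
Qed.

Variables (P : 'I_3 -> 'I_3 -> 'I_3 -> bool) (nu : U).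

(** At v = 1 the operators permute words and weights, so the trace is a sum of zeros and ones and
    nothing cancels. *)
Lemma ev_trace_neq0 a b x :
  ev (trace u kap P nu (el a b x)) != 0 <->
  exists y0 y1 y2 k, P y0 y1 y2 /\ act (y0, y1, y2, k) a b x = (y0, y1, y2, k + nu).
Proof.
rewrite /trace /tr ev_sum.
have E p : ev ((rho (el a b x) \o opD P nu) (dl p) p) =
   (let: (y0, y1, y2, k) := p in P y0 y1 y2 && (act p a b x == (y0, y1, y2, k + nu)))%:R.
  rewrite /= ev_rho ffunE; case: p => [[[y0 y1] y2] k].
  case: (act _ a b x) => [[[z0 z1] z2] l].
  rewrite -[RHS]ev_bool; congr ev; rewrite ffunE.
  have -> : (z0, z1, z2, l) == (y0, y1, y2, k + nu) = ((z0, z1, z2, l - nu) == (y0, y1, y2, k)).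
    apply/eqP/eqP => [[-> -> -> ->]|[-> -> -> <-]]; congr (_, _); ring.
  have [E|ne] := eqVneq (z0, z1, z2, l - nu) (y0, y1, y2, k).
    by rewrite andbT; case: E => -> -> -> _; case: (P _ _ _); rewrite ?ffunE ?eqxx.
  by rewrite andbF; case: (P _ _ _) => //; rewrite ffunE (negPf ne).
under eq_bigr do rewrite E.
rewrite -natr_sum Num.Theory.pnatr_eq0 sum_nat_eq0 negb_forall; split.
  move=> /existsP[[[[y0 y1] y2] k]]; rewrite eqb0 negbK => /andP[Py /eqP Ep].
  by exists y0, y1, y2, k.
move=> [y0 [y1 [y2 [k [Py Ep]]]]]; apply/existsP; exists (y0, y1, y2, k).
by rewrite Ep eqxx Py.
Qed.
End AtOne.

(** * Separation of the conjugacy classes *)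

Lemma conjP (x u w : extW) : (x * u = w * x)%g -> conj_class u w.
Proof. by move=> E; exists x; rewrite E -mulwA mulgV mulg1. Qed.

Lemma conj_el u w : conj_class u w -> exists p q z, (el p q z * u = w * el p q z)%g.
Proof.
case=> x ->; have [p [q [z ->]]] := el_surj x; exists p, q, z.
by rewrite -mulwA mulVg mulg1.
Qed.

Lemma conj_refl u : conj_class u u.
Proof. by apply: (@conjP 1%g); rewrite mul1g mulg1. Qed.

Lemma conj_sym u w : conj_class u w -> conj_class w u.
Proof.
case=> x ->; apply: (@conjP x^-1%g).
by rewrite !mulwA mulVg mul1g.
Qed.

Lemma conj_trans u w z : conj_class u w -> conj_class w z -> conj_class u z.
Proof. by case=> x -> [y ->]; exists (y * x)%g; rewrite invMg !mulwA. Qed.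

Lemma conj_class_eq u w : conj_class u w -> conj_class u = conj_class w.
Proof.
move=> uw; apply/seteqP; split=> z.
  by apply: conj_trans; apply: conj_sym.
exact: conj_trans.
Qed.

Lemma conj_translation a b x :
  conj_class (el a b We) (el (act1 x a b) (act2 x a b) We).
Proof.
by apply: (@conjP (el 0 0 x)); rewrite !elM /=; case: x => /=; rewrite !(add0r, addr0).
Qed.

(* An element [el a b w] with [w] a reflection is a reflection followed by a
   translation along its axis, whose amplitude is [refl_index]. *)
Definition refl_index (a b : int) (w : weyl) : int :=
  match w with
  | W1 => a + 2 * b | W2 => - (2 * a + b) | W121 => a - b | _ => 0 end.

Definition is_refl (w : weyl) : bool :=
  match w with W1 | W2 | W121 => true | _ => false end.

Definition is_rot (w : weyl) : bool :=
  match w with W12 | W21 => true | _ => false end.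

Lemma conj_refl_normal a b w : is_refl w ->
  conj_class (el a b w) (el (refl_index a b w) 0 W1).
Proof.
case: w => //= _.
- by apply: (@conjP (el b 0 We)); rewrite !elM; congr el => /=; lia.
- by apply: (@conjP (el (- a - b) 0 W21)); rewrite !elM; congr el => /=; lia.
- by apply: (@conjP (el (- b) 0 W2)); rewrite !elM; congr el => /=; lia.
Qed.

Lemma conj_refl_el a b w c d z : is_refl w -> is_refl z ->
  refl_index a b w = refl_index c d z -> conj_class (el a b w) (el c d z).
Proof.
move=> rw rz E; apply: conj_trans (conj_refl_normal a b rw) _.
by rewrite E; apply/conj_sym/conj_refl_normal.
Qed.

Lemma conj_rot_normal a b w c n : is_rot w -> a - b = c + 3 * n ->
  conj_class (el a b w) (el c 0 W12).
Proof.
have H12 a' b' m : a' - b' = c + 3 * m -> conj_class (el a' b' W12) (el c 0 W12).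
  move=> E; apply: (@conjP (el (- m) (- b' - m) We)).
  by rewrite !elM; congr el => /=; lia.
case: w => //= _ E; first exact: H12 E.
apply: (@conj_trans _ (el (- a) (a + b) W12)).
  by apply: (@conjP (el 0 0 W1)); rewrite !elM; congr el => /=; lia.
by apply: (H12 _ _ (n - a)); lia.
Qed.

Lemma conj_rot_el a b w c d z n : is_rot w -> is_rot z ->
  a - b = c - d + 3 * n -> conj_class (el a b w) (el c d z).
Proof.
move=> rw rz E; apply: (@conj_trans _ (el (c - d) 0 W12)).
  exact: conj_rot_normal rw E.
by apply/conj_sym/(@conj_rot_normal _ _ _ _ 0) => //; lia.
Qed.

(** These are f(T_s T_w) = f(T_w T_s) and f(T_tau T_w) = f(T_w T_tau), with the products expanded in
    the basis. *)
Definition is_trace (f : extW -> laurent) : Prop :=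
  (forall i w,
    f (simple i * w)%g + (if (ell (simple i * w)%g < ell w)%N then vq * f w else 0) =
    f (w * simple i)%g + (if (ell (w * simple i)%g < ell w)%N then vq * f w else 0)) /\
  (forall w, f (tau * w)%g = f (w * tau)%g).

HB.instance Definition _ (A B : finComNzRingType) := GRing.ComNzRing.on (A * B)%type.

Lemma intr_pair (A B : comNzRingType) (m : int) :
  (m%:~R : (A * B)%type) = (m%:~R, m%:~R).
Proof. by rewrite [LHS]surjective_pairing (raddfMz fst) (raddfMz snd). Qed.

Lemma intr_Zp_eq0 n (m : int) : (m%:~R : 'Z_n.+2) = 0 -> exists q, m = n.+2%:Z * q.
Proof.
have nat0 k : (k%:R : 'Z_n.+2) = 0 -> exists q : nat, (k = n.+2 * q)%N.
  move=> /(congr1 val); rewrite /= val_Zp_nat // => E.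
  by exists (k %/ n.+2)%N; rewrite {1}(divn_eq k n.+2) E addn0 mulnC.
case: m => k; first by move=> /nat0[q ->]; exists q%:Z; lia.
rewrite NegzE mulrNz => /eqP; rewrite oppr_eq0 => /eqP /nat0[q ->].
by exists (- q%:Z); lia.
Qed.

Lemma intr_Zp_inj n (a b : int) : (absz a + absz b < n.+2)%N ->
  (a%:~R : 'Z_n.+2) = b%:~R -> a = b.
Proof.
move=> lt E; have [|q Eq] := @intr_Zp_eq0 n (a - b).
  by rewrite mulrzBr E subrr.
have [Eq0|[Eq1|Eq1]] : q = 0 \/ 1 <= q \/ q <= -1 by lia.
- by move: Eq; rewrite Eq0; lia.
- by exfalso; nia.
- by exfalso; nia.
Qed.

(* At v = 1 the trace counts the fixed words of an element whose weight is shifted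
   by nu. Words with distinct letters see only translations, words 001 only
   translations and reflections. *)
Section Separation.
Variable N : nat.

(** The first two factors hold the weights of the letters 1 and 2, while the letter 0 weighs
    nothing; the last factor holds the class in P/Q. For [N] beyond the coordinates in play,
    equality of weights modulo [N.+2] is equality of integers. *)
Let U : finComNzRingType := ('Z_N.+2 * 'Z_N.+2 * 'Z_3)%type.

Let E (a b c : int) : U := (a%:~R, b%:~R, c%:~R).

Let ul (i : 'I_3) : U :=
  match val i with 0%N => E 0 0 0 | 1%N => E 1 0 0 | _ => E 0 1 0 end.

Let kp : U := E 0 0 1.

Let ED a b c a' b' c' : E a b c + E a' b' c' = E (a + a') (b + b') (c + c').
Proof. by rewrite /E !mulrzDr. Qed.

Let EM (m : int) a b c : m%:~R * E a b c = E (m * a) (m * b) (m * c).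
Proof. by rewrite !intr_pair /E !intrM. Qed.

Let EN a b c : - E a b c = E (- a) (- b) (- c).
Proof. by rewrite /E !mulrNz. Qed.

Let kp3 : kp *+ 3 = 0.
Proof. by rewrite -[kp *+ 3]mulr_natl -[3%:R]/(3%:~R) EM; congr (_, _); apply: val_inj. Qed.

Let cf (a b : int) (i : 'I_3) (y0 y1 y2 : 'I_3) : int :=
  (2 * a + b) * (y0 == i) + (b - a) * (y1 == i) - (a + 2 * b) * (y2 == i).

Let act_snd y0 y1 y2 k a b w : (act ul kp (y0, y1, y2, k) a b w).2 =
  k + E (cf a b o1 y0 y1 y2) (cf a b o2 y0 y1 y2) (a - b).
Proof.
have ulE (i : 'I_3) : ul i = E (i == o1) (i == o2) 0 by elim/simple_ind: i.
rewrite /act /= !ulE -[kp *~ _]mulrzl !EM EN -addrA !ED.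
by congr (_ + E _ _ _); rewrite /cf; lia.
Qed.

Let act_eq y0 y1 y2 k a b w c1 c2 c3 :
  act ul kp (y0, y1, y2, k) a b w = (y0, y1, y2, k + E c1 c2 c3) ->
  (6 * (absz a + absz b) + absz c1 + absz c2 < N)%N ->
  [/\ cf a b o1 y0 y1 y2 = c1, cf a b o2 y0 y1 y2 = c2,
     exists n, a - b = c3 + 3 * n
     & match w with
       | We => true | W1 => y0 == y1 | W2 => y1 == y2 | W121 => y0 == y2
       | _ => (y0 == y1) && (y1 == y2) end].
Proof.
move=> Eq lt; have := congr1 snd Eq; rewrite act_snd => /addrI.
move=> /(congr1 (fun p : U => (p.1.1, p.1.2, p.2))) /= [E1 E2 E3].
have bnd i : (absz (cf a b i y0 y1 y2) <= 6 * (absz a + absz b))%N.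
  by rewrite /cf; case: (y0 == i); case: (y1 == i); case: (y2 == i); lia.
split.
- by apply: (@intr_Zp_inj N) E1; have := bnd o1; lia.
- by apply: (@intr_Zp_inj N) E2; have := bnd o2; lia.
- have [|q Eq3] := @intr_Zp_eq0 1 (a - b - c3); first by rewrite mulrzBr E3 subrr.
  by exists q; lia.
by move: Eq => /(congr1 fst); case: w => //= -[]; do ![move=> ->]; rewrite ?eqxx.
Qed.

Variables (s : seq extW) (c : extW -> int).
Hypothesis s_uniq : uniq s.
Hypothesis s_conj : forall u w, u \in s -> w \in s -> conj_class u w -> u = w.
Hypothesis s_bound : forall a b x, el a b x \in s -> (24 * (absz a + absz b) < N)%N.
Hypothesis s_rel : forall f, is_trace f -> \sum_(w <- s) c w * ev (f w) = 0.

Let is_trace_trace P nu :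
  (forall x y z, P y x z = P x y z) -> (forall x y z, P x z y = P x y z) ->
  is_trace (trace ul kp P nu).
Proof.
by move=> P12 P23; split; [apply: trace_simple | apply: trace_tau].
Qed.

(** The premise [c w != 0] makes the elimination triangular: a trace may also see types of elements
    treated earlier, since their coefficients are already known to vanish. *)
Let separate (f : extW -> laurent) w0 : is_trace f -> w0 \in s -> ev (f w0) != 0 ->
  (forall w, w \in s -> c w != 0 -> ev (f w) != 0 -> conj_class w w0) -> c w0 = 0.
Proof.
move=> tf w0s nz H; have := s_rel tf.
rewrite (bigD1_seq w0) //= big_seq_cond big1 ?addr0 => [/eqP|w /andP[ws ne]].
  by rewrite mulf_eq0 (negPf nz) orbF => /eqP.
apply/eqP; apply: contraNT ne; rewrite mulf_eq0 negb_or => /andP[cw fw].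
by apply/eqP; apply: s_conj => //; apply: H.
Qed.

Let separate_translation a b : el a b We \in s -> c (el a b We) = 0.
Proof.
pose P (x y z : 'I_3) := [&& x != y, y != z & x != z].
have P12 x y z : P y x z = P x y z.
  by rewrite /P [y == x]eq_sym; do ![case: (_ == _)].
have P23 x y z : P x z y = P x y z.
  by rewrite /P [z == y]eq_sym; do ![case: (_ == _)].
(* The shift is that of the word 012 under the translation by [(a, b)]. It fixes two trace-free
   coordinates, hence all three, so another translation with this shift on a permuted word lies in
   the same Weyl orbit. *)
move=> ws; apply: (separate (is_trace_trace (E (b - a) (- (a + 2 * b)) (a - b)) P12 P23)) => //.
  apply/ev_trace_neq0; first exact: kp3.
  exists o0, o1, o2, 0; split=> //.
  rewrite [LHS]surjective_pairing act_snd; congr (_, _ + E _ _ _);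
    by rewrite /cf /=; lia.
move=> w; have [a' [b' [x ->]]] := el_surj w => ws' _.
move=> /(ev_trace_neq0 _ kp3)[y0 [y1 [y2 [k [Py]]]]] /act_eq[].
  by have := s_bound ws; have := s_bound ws'; lia.
move=> E1 E2 _ Ew.
have {Ew} -> : x = We.
  move: Py Ew; rewrite /P; case: x {ws'} => // /and3P[];
  by do ![case: (_ == _)].
have conj z : a = act1 z a' b' -> b = act2 z a' b' -> conj_class (el a' b' We) (el a b We).
  by move=> -> ->; apply: conj_translation.
move: Py E1 E2; rewrite /P /cf.
case: y0 y1 y2 => -[|[|[|//]]] ? [[|[|[|//]]] ?] [[|[|[|//]]] ?] // _ /= E1 E2.
- by apply: (conj We) => /=; lia.
- by apply: (conj W2) => /=; lia.
- by apply: (conj W1) => /=; lia.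
- by apply: (conj W12) => /=; lia.
- by apply: (conj W21) => /=; lia.
- by apply: (conj W121) => /=; lia.
Qed.

Let separate_refl a b x : is_refl x -> el a b x \in s -> c (el a b x) = 0.
Proof.
move=> rx ws.
pose P (y0 y1 y2 : 'I_3) := ((y0 == o0) + (y1 == o0) + (y2 == o0) == 2)%N &&
   ((y0 == o1) + (y1 == o1) + (y2 == o1) == 1)%N.
have P12 y0 y1 y2 : P y1 y0 y2 = P y0 y1 y2.
  by rewrite /P [((y1 == o0) + _)%N]addnC [((y1 == o1) + _)%N]addnC.
have P23 y0 y1 y2 : P y0 y2 y1 = P y0 y1 y2.
  by rewrite /P -!addnA [((y2 == o0) + _)%N]addnC [((y2 == o1) + _)%N]addnC.
(* Minus the index is three times the trace-free coordinate at the position that the reflection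
   fixes; the single letter 1 is placed there to read it off. *)
apply: (separate (is_trace_trace (E (- refl_index a b x) 0 (a - b)) P12 P23)) => //.
  apply/ev_trace_neq0; first exact: kp3.
  case: x rx {ws} => // _; [exists o0, o0, o1, 0 | exists o1, o0, o0, 0 | exists o0, o1, o0, 0];
    (split=> //; rewrite [LHS]surjective_pairing act_snd; congr (_, _ + E _ _ _);
     by rewrite /cf /=; lia).
move=> w; have [a' [b' [z ->]]] := el_surj w => ws' cw.
move=> /(ev_trace_neq0 _ kp3)[y0 [y1 [y2 [k [Py]]]]] /act_eq[].
  by have := s_bound ws; have := s_bound ws'; case: x {rx ws} => /=; lia.
move=> E1 E2 _ Ew.
have rz : is_refl z.
  case: z ws' cw Ew {E1 E2} => // [ws'|_ _|_ _]; first by rewrite separate_translation ?eqxx.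
    move=> /andP[/eqP Ey /eqP Ez]; move: Py; rewrite /P Ey Ez.
    by case: (y2 == o0); case: (y2 == o1).
  move=> /andP[/eqP Ey /eqP Ez]; move: Py; rewrite /P Ey Ez.
  by case: (y2 == o0); case: (y2 == o1).
apply: conj_refl_el => //.
move: Py E1 E2 Ew; rewrite /P /cf.
case: z rz {ws' cw} => // _;
case: y0 y1 y2 => -[|[|[|//]]] ? [[|[|[|//]]] ?] [[|[|[|//]]] ?] //= _ E1 _ _; lia.
Qed.

Let separate_rot a b x : is_rot x -> el a b x \in s -> c (el a b x) = 0.
Proof.
move=> rx ws.
pose P (y0 y1 y2 : 'I_3) := [&& y0 == o0, y1 == o0 & y2 == o0].
have P12 y0 y1 y2 : P y1 y0 y2 = P y0 y1 y2 by rewrite /P; do ![case: (_ == _)].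
have P23 y0 y1 y2 : P y0 y2 y1 = P y0 y1 y2 by rewrite /P; do ![case: (_ == _)].
(* On the constant word the letter weights cancel, and [a - b] modulo 3 is all that distinguishes
   rotations up to conjugacy. *)
apply: (separate (is_trace_trace (E 0 0 (a - b)) P12 P23)) => //.
  apply/ev_trace_neq0; first exact: kp3.
  exists o0, o0, o0, 0; split=> //; rewrite [LHS]surjective_pairing act_snd.
  by congr (_, _ + E _ _ _); rewrite ?/cf /=; [case: x rx {ws} | lia | lia].
move=> w; have [a' [b' [z ->]]] := el_surj w => ws' cw.
move=> /(ev_trace_neq0 _ kp3)[y0 [y1 [y2 [k [Py]]]]] /act_eq[].
  by have := s_bound ws'; lia.
move=> _ _ [n En] _.
have rz : is_rot z.
  by case: z ws' cw {En} => // ws';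
    rewrite (separate_translation, separate_refl) ?eqxx.
exact: conj_rot_el En.
Qed.

Lemma separate_all w : w \in s -> c w = 0.
Proof.
have [a [b [x ->]]] := el_surj w; case: x.
- exact: separate_translation.
- exact: separate_refl.
- exact: separate_refl.
- exact: separate_rot.
- exact: separate_rot.
- exact: separate_refl.
Qed.

End Separation.

(** * Linear independence in the cocenter *)

Lemma fsum_seq (I : choiceType) (V : nmodType) (A : set I) (r : seq I) (f : I -> V) :
  uniq r -> (forall i, i \in r -> A i) -> (forall i, A i -> i \notin r -> f i = 0) ->
  \sum_(i \in A) f i = \sum_(i <- r) f i.
Proof.
move=> ur rA f0; rewrite (fsbigE r) //= big_seq_cond [RHS]big_seq_cond.
by apply: eq_bigl => i; case: (boolP (i \in r)) => //= /rA Ai; rewrite mem_set.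
Qed.

Lemma finite_support_seq (I : choiceType) (c : I -> laurent) :
  finite_set [set i | c i != 0] -> exists2 r : seq I, uniq r & forall i, c i != 0 -> i \in r.
Proof.
move=> /finite_seqP[r Er]; exists (undup r); first exact: undup_uniq.
move=> i ci; rewrite mem_undup; have : [set i | c i != 0] i by [].
by rewrite Er.
Qed.

Lemma finite_support_sub (I : choiceType) (c : I -> laurent) (r : seq I) :
  (forall i, c i != 0 -> i \in r) -> finite_set [set i | c i != 0].
Proof. by move=> H; apply: sub_finite_set (finite_seq r) => i /= /H. Qed.

(** * Trace functions vanish on commutators *)

Section Functional.
Variables (H : algType laurent) (T : extW -> H).
Hypothesis hT : is_hecke_algebra T.

Lemma T_simple_sqr i : T (simple i) * T (simple i) = 1 + vq *: T (simple i).
Proof.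
have := hecke_quad hT i.
rewrite mulrDr !mulrBl -scalerAl mul1r -scalerAr mulr1 -scalerAl mul1r scalerA v_vinv scale1r.
move=> Q; rewrite /vq scalerBl; apply/eqP; rewrite -subr_eq0 -[X in _ == X]Q; apply/eqP.
by rewrite !opprD opprK -!addrA; congr (_ + _); rewrite [LHS]addrC -addrA.
Qed.

Lemma T_simple_left i u : T (simple i) * T u =
  T (simple i * u)%g + (if (ell (simple i * u)%g < ell u)%N then vq *: T u else 0).
Proof.
have up w : ell (simple i * w)%g = (ell w).+1 -> T (simple i) * T w = T (simple i * w)%g.
  move=> E; apply: (hecke_mul hT); rewrite !extlenE E -add1n; congr (_ + _)%N.
  by elim/simple_ind: i {E}; rewrite simpleE ellE.
case: (ell_simple_left i u) => E.
  by rewrite up // E ltnNge leqnSn /= addr0.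
have E' : ell (simple i * (simple i * u))%g = (ell (simple i * u)%g).+1.
  by rewrite simpleK.
have := up _ E'; rewrite simpleK E ltnSn => <-; rewrite mulrA T_simple_sqr.
by rewrite mulrDl mul1r scalerAl.
Qed.

Lemma T_simple_right i u : T u * T (simple i) =
  T (u * simple i)%g + (if (ell (u * simple i)%g < ell u)%N then vq *: T u else 0).
Proof.
have up w : ell (w * simple i)%g = (ell w).+1 -> T w * T (simple i) = T (w * simple i)%g.
  move=> E; apply: (hecke_mul hT); rewrite !extlenE E -addn1; congr (_ + _)%N.
  by elim/simple_ind: i {E}; rewrite simpleE ellE.
case: (ell_simple_right i u) => E.
  by rewrite up // E ltnNge leqnSn /= addr0.
have E' : ell (u * simple i * simple i)%g = (ell (u * simple i)%g).+1.
  by rewrite simpleKr.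
have := up _ E'; rewrite simpleKr E ltnSn => <-; rewrite -mulrA T_simple_sqr.
by rewrite mulrDr mulr1 -scalerAr.
Qed.

Lemma T_simple_up i u : ell (simple i * u)%g = (ell u).+1 ->
  T (simple i * u)%g = T (simple i) * T u.
Proof. by move=> E; rewrite T_simple_left E ltnNge leqnSn /= addr0. Qed.

Lemma ell_tau0 : ell tau = 0%N. Proof. by rewrite tauE ellE. Qed.

Lemma T_tau_left u : T tau * T u = T (tau * u)%g.
Proof. by apply: (hecke_mul hT); rewrite !extlenE ell_tau_left ell_tau0. Qed.

Lemma T_tau_right u : T u * T tau = T (u * tau)%g.
Proof. by apply: (hecke_mul hT); rewrite !extlenE ell_tau ell_tau0 addn0. Qed.

Lemma T_one_left u : T 1%g * T u = T u.
Proof.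
rewrite -[in RHS](mul1g u); apply: (hecke_mul hT).
by rewrite !extlenE mul1g el1 ellE.
Qed.

Lemma T_one_right u : T u * T 1%g = T u.
Proof.
rewrite -[in RHS](mulg1 u); apply: (hecke_mul hT).
by rewrite !extlenE mulg1 el1 ellE addn0.
Qed.

Definition coef (h : H) : extW -> laurent := sval (cid (hecke_basis hT h)).

Lemma coefP h : finite_set [set u | coef h u != 0] /\
  h = \sum_(u \in setT) coef h u *: T u.
Proof. by rewrite /coef; case: cid => c [] []. Qed.

Lemma coef_unique h c : finite_set [set u | c u != 0] ->
  h = \sum_(u \in setT) c u *: T u -> coef h = c.
Proof. by rewrite /coef; case: cid => c' [/= _ uc] fc Eh; apply: uc. Qed.

Lemma coef_seq h r : uniq r -> (forall u, coef h u != 0 -> u \in r) ->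
  h = \sum_(u <- r) coef h u *: T u.
Proof.
move=> ur sub; rewrite {1}(coefP h).2; apply: fsum_seq => // u _ nr.
have [->|/sub] := eqVneq (coef h u) 0; first by rewrite scale0r.
by rewrite (negPf nr).
Qed.

Lemma coef_eq h c r : uniq r -> (forall u, c u != 0 -> u \in r) ->
  h = \sum_(u <- r) c u *: T u -> coef h = c.
Proof.
move=> ur sub Eh; apply: coef_unique; first exact: finite_support_sub sub.
rewrite Eh; apply/esym/fsum_seq => // u _ nr.
have [->|/sub] := eqVneq (c u) 0; first by rewrite scale0r.
by rewrite (negPf nr).
Qed.

Lemma coef_T u : coef (T u) = fun w => (w == u)%:R.
Proof.
apply: (@coef_eq _ _ [:: u]) => // [w|].
  by rewrite inE; case: (w == u); rewrite ?eqxx.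
by rewrite big_seq1 eqxx scale1r.
Qed.

Lemma coef_comb a h h' : coef (a *: h + h') = fun u => a * coef h u + coef h' u.
Proof.
have [r1 u1 s1'] := finite_support_seq (coefP h).1.
have [r2 u2 s2'] := finite_support_seq (coefP h').1.
pose r := undup (r1 ++ r2); have ur : uniq r by apply: undup_uniq.
have sub1 u : coef h u != 0 -> u \in r by rewrite mem_undup mem_cat => /s1' ->.
have sub2 u : coef h' u != 0 -> u \in r by rewrite mem_undup mem_cat orbC => /s2' ->.
apply: (@coef_eq _ _ r ur) => [u|].
  apply: contraTT => nr; rewrite negbK.
  have [->|/sub1] := eqVneq (coef h u) 0; last by rewrite (negPf nr).
  have [->|/sub2] := eqVneq (coef h' u) 0; last by rewrite (negPf nr).
  by rewrite mulr0 addr0.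
rewrite {1}(coef_seq ur sub1) {1}(coef_seq ur sub2) scaler_sumr -big_split /=.
by apply: eq_bigr => u _; rewrite scalerDl scalerA.
Qed.

Section Linear.
Variable f : extW -> laurent.

Definition lf (h : H) : laurent := \sum_(u \in setT) coef h u * f u.

Lemma lf_seq h r : uniq r -> (forall u, coef h u != 0 -> u \in r) ->
  lf h = \sum_(u <- r) coef h u * f u.
Proof.
move=> ur sub; apply: fsum_seq => // u _ nr.
have [->|/sub] := eqVneq (coef h u) 0; first by rewrite mul0r.
by rewrite (negPf nr).
Qed.

Lemma lf_T u : lf (T u) = f u.
Proof.
rewrite (@lf_seq _ [:: u]) // => [|w]; rewrite coef_T.
  by rewrite big_seq1 eqxx mul1r.
by rewrite inE; case: (w == u); rewrite ?eqxx.
Qed.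

Lemma lf_comb a h h' : lf (a *: h + h') = a * lf h + lf h'.
Proof.
have [r1 u1 s1'] := finite_support_seq (coefP h).1.
have [r2 u2 s2'] := finite_support_seq (coefP h').1.
pose r := undup (r1 ++ r2); have ur : uniq r by apply: undup_uniq.
have sub1 u : coef h u != 0 -> u \in r by rewrite mem_undup mem_cat => /s1' ->.
have sub2 u : coef h' u != 0 -> u \in r by rewrite mem_undup mem_cat orbC => /s2' ->.
rewrite (lf_seq ur sub1) (lf_seq ur sub2) (@lf_seq _ r ur) => [|u]; rewrite coef_comb.
  rewrite mulr_sumr -big_split; apply: eq_bigr => u _.
  by rewrite mulrDl mulrA.
apply: contraTT => nr; rewrite negbK.
have [->|/sub1] := eqVneq (coef h u) 0; last by rewrite (negPf nr).
have [->|/sub2] := eqVneq (coef h' u) 0; last by rewrite (negPf nr).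
by rewrite mulr0 addr0.
Qed.

Lemma lf0 : lf 0 = 0.
Proof.
have := lf_comb (-1) 0 0; rewrite scaler0 add0r => E.
by rewrite E mulN1r addNr.
Qed.

Lemma lfD h h' : lf (h + h') = lf h + lf h'.
Proof. by rewrite -[h]scale1r lf_comb mul1r scale1r. Qed.

Lemma lfZ a h : lf (a *: h) = a * lf h.
Proof. by rewrite -[a *: h]addr0 lf_comb lf0 addr0. Qed.

Lemma lfB h h' : lf (h - h') = lf h - lf h'.
Proof. by rewrite -scaleN1r lfD lfZ mulN1r. Qed.

Lemma lf_sum (I : Type) (r : seq I) (F : I -> H) :
  lf (\sum_(i <- r) F i) = \sum_(i <- r) lf (F i).
Proof. exact: (big_morph lf lfD lf0). Qed.

Hypothesis tf : is_trace f.

(** This property is stable under products, so it spreads from the T_s and T_tau, where it is the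
    trace identity [tf], to the whole basis. *)
Let central g := forall h, lf (h * g) = lf (g * h).

Let central_T g : (forall u, lf (T u * g) = lf (g * T u)) -> central g.
Proof.
move=> E h; have [r ur sr] := finite_support_seq (coefP h).1.
rewrite (coef_seq ur sr) mulr_suml mulr_sumr !lf_sum; apply: eq_bigr => u _.
by rewrite -scalerAl -scalerAr !lfZ E.
Qed.

Let central_simple i : central (T (simple i)).
Proof.
apply: central_T => u; have L (b : bool) : lf (if b then vq *: T u else 0) = if b then vq * f u else 0.
  by case: b; rewrite ?lfZ ?lf_T ?lf0.
by rewrite T_simple_left T_simple_right !lfD !lf_T !L tf.1.
Qed.

Let central_tau : central (T tau).
Proof. by apply: central_T => u; rewrite T_tau_left T_tau_right !lf_T tf.2. Qed.

Let central_mul g g' : central g -> central g' -> central (g * g').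
Proof. by move=> cg cg' h; rewrite mulrA cg' mulrA cg mulrA. Qed.

Let central_basis u : central (T u).
Proof.
move: {2}(ell u) (erefl (ell u)) => n; elim: n u => [|n IH] u lu; last first.
  have [i li] := ell_descent lu; rewrite -(simpleK i u) T_simple_up; last by rewrite simpleK li lu.
  by apply: central_mul => //; apply: IH.
have [j ->] := ell0 lu; elim: j => [|j IH].
  by apply: central_T => w; rewrite expg0 T_one_left T_one_right.
by rewrite tau_expS -T_tau_left; apply: central_mul.
Qed.

Lemma lf_commutator h : commutator_span h -> lf h = 0.
Proof.
case=> s ->; rewrite lf_sum big1 // => -[a [x y]] _ /=.
rewrite lfZ lfB; have [r ur sr] := finite_support_seq (coefP y).1.
rewrite (coef_seq ur sr) mulr_suml mulr_sumr !lf_sum -sumrB big1 ?mulr0 // => u _.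
by rewrite -scalerAl -scalerAr !lfZ central_basis subrr.
Qed.

End Linear.

End Functional.

(** * Clearing denominators and dividing by v - 1 *)

Lemma pol_subproof (p : {poly int}) : tofrac p \in laurent_pred.
Proof. by apply/asboolP; exists p, 0%N; rewrite expr0 tofrac1 divr1. Qed.

Definition pol (p : {poly int}) : laurent := Laurent (pol_subproof p).

Lemma polM p q : pol (p * q) = pol p * pol q.
Proof. by apply: val_inj; rewrite rmorphM /= tofracM. Qed.

Lemma pol0 : pol 0 = 0.
Proof. by apply: val_inj; rewrite /= tofrac0. Qed.

Lemma pol_eq0 p : pol p = 0 -> p = 0.
Proof. by move=> /(congr1 val) /= /eqP; rewrite tofrac_eq0 => /eqP. Qed.

Lemma ev_pol p : ev (pol p) = p.[1].
Proof. by apply: (@evE _ p 0); rewrite expr0 tofrac1 divr1. Qed.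

Lemma laurent_mulf_eq0 (x y : laurent) : x * y = 0 -> x != 0 -> y = 0.
Proof.
move=> /(congr1 val); rewrite rmorphM /= => /eqP; rewrite mulf_eq0 => /orP[/eqP x0|/eqP y0].
  by move=> /eqP[]; apply: val_inj.
by move=> _; apply: val_inj.
Qed.

Lemma laurent_numer (x : laurent) : exists p n, pol p = pol 'X^n * x.
Proof.
have [[p n] /= E] := laurent_frac x; exists p, n; apply: val_inj.
by rewrite rmorphM /= E mulrC divfK // tofracXn_neq0.
Qed.

Lemma polXn_neq0 n : pol 'X^n != 0.
Proof. by apply/eqP => /pol_eq0 /eqP; rewrite expf_eq0 polyX_eq0 andbF. Qed.

Lemma laurent_numers (I : eqType) (r : seq I) (c : I -> laurent) :
  exists n, forall i, i \in r -> exists p, pol p = pol 'X^n * c i.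
Proof.
elim: r => [|j r [n IH]]; first by exists 0%N.
have [p [k Ep]] := laurent_numer (c j); exists (n + k)%N => i; rewrite inE => /orP[/eqP->|/IH[q Eq]].
  by exists ('X^n * p); rewrite polM Ep exprD polM mulrA.
by exists ('X^k * q); rewrite polM Eq addnC exprD polM mulrA.
Qed.

Lemma fsum_comb (I : choiceType) (H : lmodType laurent) (A : set I) (F : I -> H)
    (c c' : I -> laurent) a :
  finite_set [set i | c i != 0] -> finite_set [set i | c' i != 0] ->
  (forall i, c i != 0 -> A i) -> (forall i, c' i != 0 -> A i) ->
  \sum_(i \in A) (a * c i + c' i) *: F i =
  a *: (\sum_(i \in A) c i *: F i) + \sum_(i \in A) c' i *: F i.
Proof.
move=> /finite_support_seq[r1 u1 s1'] /finite_support_seq[r2 u2 s2'] C1 C2.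
pose r := undup [seq i <- r1 ++ r2 | i \in A].
have ur : uniq r by apply: undup_uniq.
have rC i : i \in r -> A i by rewrite mem_undup mem_filter => /andP[/set_mem].
have Z (d : I -> laurent) (r' : seq I) : {subset r' <= r1 ++ r2} ->
    (forall i, d i != 0 -> i \in r') -> (forall i, d i != 0 -> A i) ->
    forall i, i \notin r -> d i = 0.
  move=> sub sr' C i; rewrite mem_undup mem_filter => nr; apply/eqP; apply: contraNT nr => nz.
  by apply/andP; split; [apply: mem_set; exact: C nz | exact: sub (sr' _ nz)].
have Z1 : forall i, i \notin r -> c i = 0.
  by apply: Z s1' C1 => i; rewrite mem_cat => ->.
have Z2 : forall i, i \notin r -> c' i = 0.
  by apply: Z s2' C2 => i; rewrite mem_cat orbC => ->.
have S d : (forall i, i \notin r -> d i = 0) ->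
    \sum_(i \in A) d i *: F i = \sum_(i <- r) d i *: F i.
  move=> Zd; apply: (@fsum_seq I H A r (fun i => d i *: F i) ur rC) => i Ai nr.
  by rewrite (Zd i nr) scale0r.
rewrite (S c Z1) (S c' Z2) (S (fun i => a * c i + c' i)) => [|i nr]; last first.
  by rewrite (Z1 i nr) (Z2 i nr) mulr0 addr0.
rewrite scaler_sumr -big_split; apply: eq_bigr => i _.
by rewrite scalerDl scalerA.
Qed.

Section Independence.
Variable m : set extW -> extW.
Hypothesis hm : min_length_rep m.

Lemma m_class O : conj_classes O -> O = conj_class (m O).
Proof.
move=> CO; have [mO _] := hm CO; case: CO mO => u _ <- mO.
exact: conj_class_eq.
Qed.

Lemma exists_bound (s : seq extW) : exists N, forall a b x,
  el a b x \in s -> (24 * (absz a + absz b) < N)%N.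
Proof.
elim: s => [|u s [N IH]]; first by exists 0%N.
have [a [b [x ->]]] := el_surj u.
exists (24 * (absz a + absz b) + N).+1 => a' b' x'; rewrite inE => /orP[/eqP|/IH]; last by lia.
by move=> /el_inj[-> -> _]; lia.
Qed.

(* At v = 1 all coefficients vanish, so they are divisible by X - 1, and the
   quotients satisfy the same relations. *)
Lemma poly_independent (r : seq (set extW)) n (p : set extW -> {poly int}) :
  uniq r -> (forall O, O \in r -> conj_classes O) ->
  (forall O, O \in r -> (size (p O) <= n)%N) ->
  (forall f, is_trace f -> \sum_(O <- r) pol (p O) * f (m O) = 0) ->
  forall O, O \in r -> p O = 0.
Proof.
move=> ur rC; elim: n p => [|n IH] p sp rel.
  by move=> O Or; apply/eqP; rewrite -size_poly_leq0 sp.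
have p1 O : O \in r -> (p O).[1] = 0.
  move=> Or; pose c w := ev (pol (p (conj_class w))).
  have cm O' : O' \in r -> c (m O') = (p O').[1].
    by move=> O'r; rewrite /c -m_class ?ev_pol //; apply: rC.
  have [N bN] := exists_bound (map m r).
  rewrite -cm //; apply: (@separate_all N (map m r)) => //; last exact: map_f.
  - rewrite map_inj_in_uniq // => O1 O2 O1r O2r E.
    by rewrite (m_class (rC _ O1r)) E -m_class //; apply: rC.
  - move=> u w /mapP[O1 O1r ->] /mapP[O2 O2r ->] E; congr m.
    by rewrite (m_class (rC _ O1r)) (m_class (rC _ O2r)) (conj_class_eq E).
  move=> f /rel /(congr1 ev); rewrite ev_sum ev0 big_map => E; rewrite -[RHS]E.
  by apply: eq_big_seq => O' O'r; rewrite evM cm // ev_pol.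
have /choice[q Eq] : forall O, exists q, O \in r -> p O = q * ('X - 1%:P).
  move=> O; case: (boolP (O \in r)) => [Or|]; last by exists 0.
  by have /eqP/factor_theorem[q Eq] := p1 _ Or; exists q.
have X1 : ('X - 1%:P : {poly int}) != 0 by rewrite polyXsubC_eq0.
suff q0 O : O \in r -> q O = 0 by move=> O Or; rewrite Eq // q0 // mul0r.
apply: (IH q) O => [O Or|f tf].
  have := sp _ Or; rewrite Eq //; have [->|nz] := eqVneq (q O) 0; first by rewrite size_poly0.
  by rewrite size_Mmonic ?monicXsubC // size_XsubC addn2.
apply: (@laurent_mulf_eq0 (pol ('X - 1%:P))); last first.
  by apply/eqP => /pol_eq0 /eqP; rewrite (negPf X1).
rewrite -[RHS](rel f tf) mulr_sumr; apply: eq_big_seq => O Or.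
by rewrite (Eq _ Or) polM mulrA [pol _ * pol _]mulrC.
Qed.

Variables (H : algType laurent) (T : extW -> H).
Hypothesis hT : is_hecke_algebra T.

Lemma cocenter_independent (c : set extW -> laurent) :
  (forall O, c O != 0 -> conj_classes O) -> finite_set [set O | c O != 0] ->
  commutator_span (\sum_(O \in conj_classes) c O *: T (m O)) ->
  forall O, c O = 0.
Proof.
move=> cC /finite_support_seq[r0 ur0 sr0] cs O.
pose r := [seq O <- r0 | c O != 0].
have ur : uniq r by apply: filter_uniq.
have rC O' : O' \in r -> conj_classes O' by rewrite mem_filter => /andP[/cC].
have rel f : is_trace f -> \sum_(O <- r) c O * f (m O) = 0.
  move=> tf; have := lf_commutator hT tf cs; rewrite (fsum_seq ur rC) => [|O' _ nr].
    rewrite lf_sum => E; rewrite -[RHS]E; apply: eq_bigr => O' _.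
    by rewrite lfZ lf_T.
  case: (eqVneq (c O') 0) => [->|nz]; first by rewrite scale0r.
  by move: nr; rewrite mem_filter nz sr0.
have [n num] := laurent_numers r c.
have /choice[p Ep] : forall O, exists p, O \in r -> pol p = pol 'X^n * c O.
  move=> O'; case: (boolP (O' \in r)) => [/num[p Ep]|_]; first by exists p.
  by exists 0.
apply/eqP; apply: contraT => cO.
have Or : O \in r by rewrite mem_filter cO sr0.
case/eqP: cO; apply: (laurent_mulf_eq0 _ (polXn_neq0 n)); rewrite -Ep // -pol0; congr pol.
apply: (@poly_independent r (\max_(O <- r) size (p O)) p) => // [O' O'r|f tf].
  by rewrite (big_rem O') //= leq_maxl.
transitivity (pol ('X^n) * (\sum_(O <- r) c O * f (m O))); last by rewrite rel // mulr0.
rewrite mulr_sumr; apply: eq_big_seq => O' O'r.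
by rewrite Ep // mulrA.
Qed.

Lemma span_comb a (h h' : H) : commutator_span h -> commutator_span h' ->
  commutator_span (a *: h + h').
Proof.
case=> s -> [s' ->]; exists ([seq (a * p.1, p.2) | p <- s] ++ s').
rewrite big_cat big_map scaler_sumr; congr (_ + _).
by apply: eq_bigr => p _; rewrite scalerA.
Qed.

Lemma span0 : commutator_span (0 : H).
Proof. by exists [::]; rewrite big_nil. Qed.

Lemma spanN (h : H) : commutator_span h -> commutator_span (- h).
Proof. by move=> sh; rewrite -[- h]addr0 -scaleN1r; apply: span_comb sh span0. Qed.

Lemma spanD (h h' : H) : commutator_span h -> commutator_span h' -> commutator_span (h + h').
Proof. by move=> sh sh'; rewrite -[h]scale1r; apply: span_comb. Qed.

Lemma finite_support_comb (c c' : set extW -> laurent) a :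
  finite_set [set O | c O != 0] -> finite_set [set O | c' O != 0] ->
  finite_set [set O | a * c O + c' O != 0].
Proof.
move=> fc fc'; apply: (@sub_finite_set _ _ ([set O | c O != 0] `|` [set O | c' O != 0])).
  move=> O /= nz; case: (eqVneq (c O) 0) => [c0|]; last by left.
  by right; apply: contraNneq nz => ->; rewrite c0 mulr0 addr0.
by rewrite finite_setU.
Qed.

Lemma expansion_unique w c c' :
  cocenter_expansion T m w c -> cocenter_expansion T m w c' -> c = c'.
Proof.
case=> C1 F1 S1 [C2 F2 S2]; apply/funext => O; apply/eqP; rewrite -subr_eq0; apply/eqP.
rewrite addrC -mulN1r; apply: (@cocenter_independent (fun O => -1 * c' O + c O)).
- move=> O' nz; case: (eqVneq (c O') 0) => [c0|]; last exact: C1.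
  by apply: C2; apply: contraNneq nz => ->; rewrite c0 mulr0 addr0.
- exact: finite_support_comb.
rewrite (fsum_comb _ _ F2 F1 C2 C1) scaleN1r.
have := spanD S2 (spanN S1); rewrite opprB addrC addrA subrK; congr commutator_span.
by rewrite addrC.
Qed.

Lemma class_polyE w c : cocenter_expansion T m w c -> class_poly T m w = c.
Proof.
move=> ec; apply: xget_unique; first by split=> // c'; apply: expansion_unique.
by move=> c' [ec' _]; apply: expansion_unique ec' ec.
Qed.

End Independence.

(** * Reduction modulo commutators *)

Lemma conj_inv a b x c d y : conj_class (el a b x) (el c d y) ->
  [/\ is_refl x = is_refl y, is_rot x = is_rot y,
      refl_index a b x = refl_index c d y & exists n, a - b = c - d + 3 * n].
Proof.
move=> /conj_el[p [q [z]]]; rewrite !elM => /el_inj[E1 E2 Ew].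
case: z E1 E2 Ew; case: x; case: y => //= E1 E2 _; split=> //; try lia.
all: by exists ((a - b - (c - d)) %/ 3)%Z; lia.
Qed.

Lemma conj_translation_inv a b c d y : conj_class (el a b We) (el c d y) ->
  y = We /\ exists z, c = act1 z a b /\ d = act2 z a b.
Proof.
move=> /conj_el[p [q [z]]]; rewrite !elM => /el_inj[E1 E2 Ew].
have yE : y = We by case: z Ew {E1 E2}; case: y.
split=> //; exists z; move: E1 E2; rewrite yE /=.
by split; lia.
Qed.

(** One family over all integers covers C_i for positive and C'_i for negative index. The factor 3
    appears because [refl_index] is congruent to [a - b] modulo 3 on reflections, so it is divisible
    by 3 exactly inside W_a. *)
Definition reflC (i : int) : set extW := conj_class (el (3 * i) 0 W1).

Lemma reflC_el i a b x : is_refl x -> refl_index a b x = 3 * i -> reflC i (el a b x).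
Proof. by move=> rx E; apply: conj_refl_el => //=; lia. Qed.

Lemma reflCP i u : reflC i u ->
  exists a b x, [/\ u = el a b x, is_refl x & refl_index a b x = 3 * i].
Proof.
have [a [b [x ->]]] := el_surj u => /conj_inv[/= Er _ Ei _].
by exists a, b, x; split=> //; lia.
Qed.

Lemma reflCE i a b x : is_refl x -> refl_index a b x = 3 * i ->
  conj_class (el a b x) = reflC i.
Proof. by move=> rx E; apply/esym/conj_class_eq; apply: reflC_el. Qed.

Lemma reflC_inj i j : reflC i = reflC j -> i = j.
Proof.
move=> E; have : reflC j (el (3 * i) 0 W1) by rewrite -E; apply: conj_refl.
by move=> /conj_inv[_ _ /= Ei _]; lia.
Qed.

Lemma class_CE i : class_C i = reflC i%:Z.
Proof.
apply/seteqP; split=> [u [k [] ->]|u /reflCP[a [b [x [-> rx E]]]]].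
- by rewrite root_combE tE s1E elM; apply: reflC_el => //=; lia.
- by rewrite root_combE tE s2E elM; apply: reflC_el => //=; lia.
- by rewrite root_combE tE s1E s2E !elM; apply: reflC_el => //=; lia.
case: x rx E => //= _ E.
- exists (2 * i%:Z - b); constructor 1.
  by rewrite root_combE tE s1E elM; congr el => /=; lia.
- exists (- (2 * i%:Z) - a); constructor 2.
  by rewrite root_combE tE s2E elM; congr el => /=; lia.
- exists (a - i%:Z); constructor 3.
  by rewrite root_combE tE s1E s2E !elM; congr el => /=; lia.
Qed.

Lemma class_C'E i : class_C' i = reflC (- i%:Z).
Proof.
apply/seteqP; split=> [u [k [] ->]|u /reflCP[a [b [x [-> rx E]]]]].
- by rewrite root_combE tE s1E elM; apply: reflC_el => //=; lia.
- by rewrite root_combE tE s2E elM; apply: reflC_el => //=; lia.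
- by rewrite root_combE tE s1E s2E !elM; apply: reflC_el => //=; lia.
case: x rx E => //= _ E.
- exists (- (2 * i%:Z) - b); constructor 1.
  by rewrite root_combE tE s1E elM; congr el => /=; lia.
- exists (2 * i%:Z - a); constructor 2.
  by rewrite root_combE tE s2E elM; congr el => /=; lia.
- exists (a + 2 * i%:Z); constructor 3.
  by rewrite root_combE tE s1E s2E !elM; congr el => /=; lia.
Qed.

Lemma class_O2E : class_O2 = conj_class (el 0 0 W12).
Proof.
have rootP a b : rootQ (a, b) <-> exists n, a - b = 3 * n.
  split=> [[p [q]]|[n E]]; first by rewrite root_combE => -[-> ->]; exists (p - q); lia.
  by exists (b + 2 * n), (b + n); rewrite root_combE; congr (_, _); lia.
apply/seteqP; split=> [u [[a b] /rootP[n E] []] ->|u].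
- by rewrite tE s1E s2E !elM; apply: (@conj_rot_el _ _ _ _ _ _ (- n)) => //=; lia.
- by rewrite tE s1E s2E !elM; apply: (@conj_rot_el _ _ _ _ _ _ (- n)) => //=; lia.
have [a [b [x ->]]] := el_surj u => /conj_inv[_ rx _ [n E]].
exists (a, b); first by apply/rootP; exists (- n); lia.
rewrite tE s1E s2E !elM; case: x rx => //= _; [left|right]; congr el; lia.
Qed.

Lemma class_lenE O u : O u -> (forall w, O w -> (ell u <= ell w)%N) -> class_len O = ell u.
Proof.
move=> Ou le; apply: leastE; first by exists u => //; rewrite extlenE.
by move=> p [w Ow <-]; rewrite extlenE; apply: le.
Qed.

Lemma class_len_le u w : conj_class u w -> (class_len (conj_class u) <= ell w)%N.
Proof.
move=> uw; rewrite /class_len /least; case: xgetP => [n _ [_ le]|_] //.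
by apply: le; exists w => //; rewrite extlenE.
Qed.

(** In the length of an element of [reflC i], two of the three terms already add up to at least
    3|i|. The total is odd, as for every reflection, which costs one more when [i] is even. *)
Definition refl_len (i : int) : nat := (3 * absz i + ~~ odd (absz i))%N.

Lemma refl_len_le i a b x : is_refl x -> refl_index a b x = 3 * i ->
  (refl_len i <= ell (el a b x))%N.
Proof.
rewrite /refl_len ellE => rx E; have := odd_double_half (absz i).
by case: (odd _) => /= Eh; case: x rx E => //= _ E; lia.
Qed.

Lemma class_len_reflC i : class_len (reflC i) = refl_len i.
Proof.
(* The remaining term is [absz (2 * m + i - 1)]. The witnesses make [2 * m + i] equal to 1 for odd
   [i] and to 0 for even [i], the best that parity permits. *)
have [m Em] : exists m, ell (el (- 2 * i - m) (2 * m + i) W2) = refl_len i.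
  rewrite /refl_len; have := odd_double_half (absz i); case: (odd _) => /= Eh.
    by exists ((1 - i) %/ 2)%Z; rewrite ellE /=; lia.
  by exists ((- i) %/ 2)%Z; rewrite ellE /=; lia.
rewrite -Em; apply: class_lenE; first by apply: reflC_el => //=; lia.
by move=> w /reflCP[a [b [x [-> rx E]]]]; rewrite Em; apply: refl_len_le.
Qed.

Lemma refl_len_mono i j : (refl_len i%:Z <= refl_len j%:Z)%N = (i <= j)%N.
Proof.
have [->|ne] := eqVneq i j; first by rewrite !leqnn.
by rewrite /refl_len /=; case: (odd i); case: (odd j) => /=; apply/idP/idP; lia.
Qed.

Lemma refl_lenN i : refl_len (- i) = refl_len i.
Proof. by rewrite /refl_len abszN. Qed.

(** * Conjugations that keep or lower the length *)

Section Moves.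
Variables (H : algType laurent) (T : extW -> H).
Hypothesis hT : is_hecke_algebra T.

Definition eqT (u w : extW) : Prop := commutator_span (T u - T w).

Lemma span_comm (x y : H) : commutator_span (x * y - y * x).
Proof. by exists [:: (1, (x, y))]; rewrite big_seq1 scale1r. Qed.

Lemma eqT_refl u : eqT u u.
Proof. by rewrite /eqT subrr; apply: span0. Qed.

Lemma eqT_sym u w : eqT u w -> eqT w u.
Proof. by move=> /spanN; rewrite opprB. Qed.

Lemma eqT_trans w u z : eqT u w -> eqT w z -> eqT u z.
Proof. by move=> uw wz; have := spanD uw wz; rewrite addrA subrK. Qed.

Lemma eqT_shift i u : ell (simple i * u * simple i)%g = ell u ->
  (ell (simple i * u)%g < ell u)%N \/ (ell (u * simple i)%g < ell u)%N ->
  eqT u (simple i * u * simple i)%g.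
Proof.
move=> E [lt|lt].
  have E1 : ell u = (ell (simple i * u)%g).+1 by have := ell_simple_left i u; lia.
  have := span_comm (T (simple i)) (T (simple i * u)%g).
  rewrite -(T_simple_up hT) simpleK ?E1 //.
  by rewrite (T_simple_right hT) E E1 ltnNge leqnSn addr0.
have E1 : ell u = (ell (u * simple i)%g).+1 by have := ell_simple_right i u; lia.
have := span_comm (T (u * simple i)%g) (T (simple i)).
have E2 : ell (simple i * (u * simple i))%g = (ell (u * simple i)%g).+1.
  by rewrite mulwA E.
rewrite -(T_simple_up hT E2) (T_simple_right hT) simpleKr E1 ltnNge leqnSn addr0.
by rewrite mulwA.
Qed.

Lemma eqT_reduce i u : ell u = (ell (simple i * u * simple i)%g).+2 ->
  commutator_span (T u - (T (simple i * u * simple i)%g + vq *: T (simple i * u)%g)).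
Proof.
move=> E; have E1 : ell u = (ell (simple i * u)%g).+1.
  have := ell_simple_left i u; have := ell_simple_right i (simple i * u)%g; lia.
have := span_comm (T (simple i)) (T (simple i * u)%g).
rewrite -(T_simple_up hT) simpleK ?E1 // (T_simple_right hT).
by rewrite (_ : (_ < _)%N) //; lia.
Qed.

Lemma eqT_tau u : eqT (tau * u)%g (u * tau)%g.
Proof. by rewrite /eqT -(T_tau_left hT) -(T_tau_right hT); apply: span_comm. Qed.

Lemma eqT_shift_el i a b x c d y :
  (simple i * el a b x * simple i)%g = el c d y -> ell (el c d y) = ell (el a b x) ->
  (ell (simple i * el a b x)%g < ell (el a b x))%N \/
  (ell (el a b x * simple i)%g < ell (el a b x))%N ->
  eqT (el a b x) (el c d y).
Proof. by move=> <-; apply: eqT_shift. Qed.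

(** For [a = 0] the reflection fixes the coweight. Otherwise exactly one of the two products of the
    translation with s1 is shorter, and the conjugation passes through it. *)
Lemma eqT_translation_s1 a b : eqT (el a b We) (el (- a) (a + b) We).
Proof.
have [->|a0] := eqVneq a 0; first by rewrite oppr0 add0r; apply: eqT_refl.
apply: (@eqT_shift_el o1); rewrite ?simpleE ?elM ?ellE /=.
- by congr el; lia.
- by lia.
- by lia.
Qed.

Lemma eqT_translation_s2 a b : eqT (el a b We) (el (a + b) (- b) We).
Proof.
have [->|b0] := eqVneq b 0; first by rewrite oppr0 addr0; apply: eqT_refl.
apply: (@eqT_shift_el o2); rewrite ?simpleE ?elM ?ellE /=.
- by congr el; lia.
- by lia.
- by lia.
Qed.

Lemma eqT_translation a b x : eqT (el a b We) (el (act1 x a b) (act2 x a b) We).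
Proof.
have S1 := eqT_translation_s1; have S2 := eqT_translation_s2.
case: x => /=.
- exact: eqT_refl.
- exact: S1.
- exact: S2.
- have -> : el (- a - b) a We = el (- (a + b)) (a + b + - b) We by congr el; lia.
  exact: eqT_trans (S2 a b) (S1 _ _).
- have -> : el b (- a - b) We = el (- a + (a + b)) (- (a + b)) We by congr el; lia.
  exact: eqT_trans (S1 a b) (S2 _ _).
- have -> : el (- b) (- a) We = el (- (- a + (a + b))) (- a + (a + b) + - (a + b)) We.
    by congr el; lia.
  exact: eqT_trans (eqT_trans (S1 a b) (S2 _ _)) (S1 _ _).
Qed.

Lemma eqT_tau_el a b x c d y : (tau * el a b x)%g = (el c d y * tau)%g ->
  eqT (el a b x) (el c d y).
Proof.
move=> E; have E3 : (el a b x = el a b x * tau ^+ 2 * tau)%g.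
  by rewrite -mulwA -tau_expSr tau3 mulg1.
have := eqT_tau (el a b x * tau ^+ 2)%g; rewrite -E3 mulwA E => /eqT_sym.
by rewrite -mulwA -tau_expS tau3 mulg1.
Qed.

(* The element t^(- i alpha1 + m alpha2) s2: every element of [reflC i] is conjugate to
   one of these by a power of tau. *)
Definition reflF (i m : int) : extW := el (- 2 * i - m) (2 * m + i) W2.

Lemma eqT_W1_reflF a b i m : a = 2 * m + i -> b = i - m -> eqT (el a b W1) (reflF i m).
Proof.
by move=> -> ->; apply: eqT_tau_el; rewrite tauE !elM; congr el => /=; lia.
Qed.

Lemma eqT_reflF i a b x : is_refl x -> refl_index a b x = 3 * i ->
  exists m, eqT (el a b x) (reflF i m) /\ ell (reflF i m) = ell (el a b x).
Proof.
have W1F c d : c + 2 * d = 3 * i ->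
    exists m, eqT (el c d W1) (reflF i m) /\ ell (reflF i m) = ell (el c d W1).
  move=> E; exists (i - d); split; last by rewrite !ellE /=; lia.
  by apply: eqT_W1_reflF; lia.
case: x => //= _ E; first exact: W1F.
- exists (- 2 * i - a); rewrite /reflF (_ : - 2 * i - (- 2 * i - a) = a); last by lia.
  by rewrite (_ : 2 * (- 2 * i - a) + i = b); [split; first exact: eqT_refl | lia].
- have [|m [Em lm]] := W1F (2 - a - b) (a - 1); first by lia.
  exists m; split; last by rewrite lm !ellE /=; lia.
  apply: eqT_trans Em; apply: eqT_tau_el; rewrite tauE !elM; congr el => /=; lia.
Qed.

(** In this range [reflF i m] has length 3|i| + |2m + i - 1|. Followed by a conjugation by [tau],
    the move exchanges [m] and [1 - i - m], the symmetry of this formula. *)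
Lemma eqT_reflF_swap i m :
  (0 <= i /\ 1 - 2 * i <= m <= i) \/ (i <= 0 /\ i + 1 <= m <= - 2 * i) ->
  eqT (reflF i m) (el (2 - 2 * m - i) (2 * i - 1 + m) W1).
Proof.
move=> rg; apply: (@eqT_shift_el o0); rewrite ?simpleE ?elM ?ellE /=.
- by congr el => /=; lia.
- by lia.
- by lia.
Qed.
End Moves.

(** * Expansions of the elements that the chain produces *)

Definition delta (C O : set extW) : laurent := (O == C)%:R.
Definition indic (S : set (set extW)) (O : set extW) : laurent := (O \in S)%:R.

Lemma indic0 O : indic set0 O = 0.
Proof. by rewrite /indic in_set0. Qed.

Lemma indic1 S C O : ~ S C -> indic (C |` S) O = delta C O + indic S O.
Proof.
move=> nC; rewrite /indic /delta; have [->|ne] := eqVneq O C.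
  by rewrite (memNset nC) addr0 mem_set //; left.
rewrite add0r; congr (nat_of_bool _)%:R; apply/idP/idP => /set_mem SO; apply: mem_set.
  by case: SO => // OC; rewrite OC eqxx in ne.
by right.
Qed.

Lemma dominant_class_inj (a b c d : int) : 0 < a -> 0 < b -> 0 < c -> 0 < d ->
  conj_class (el a b We) = conj_class (el c d We) -> a = c /\ b = d.
Proof.
move=> a0 b0 c0 d0 E.
have : conj_class (el a b We) (el c d We) by rewrite E; apply: conj_refl.
by move=> /conj_translation_inv[_ [z]]; case: z => /= -[]; lia.
Qed.

Section Expansion.
Variables (H : algType laurent) (T : extW -> H) (m : set extW -> extW).
Hypotheses (hT : is_hecke_algebra T) (hm : min_length_rep m).

Local Notation expansion := (cocenter_expansion T m).

Lemma expansion_ext u c c' : c =1 c' -> expansion u c -> expansion u c'.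
Proof. by move=> /funext ->. Qed.

Lemma expansion_eqT u w c : eqT T u w -> expansion w c -> expansion u c.
Proof.
move=> uw [C F S]; split=> //; have := spanD uw S.
by rewrite addrA subrK.
Qed.

Lemma expansion_step u w w' c c' :
  commutator_span (T u - (T w + vq *: T w')) ->
  expansion w c -> expansion w' c' -> expansion u (fun O => vq * c' O + c O).
Proof.
move=> S [C F Sw] [C' F' Sw']; split.
- move=> O nz; have [c0|] := eqVneq (c O) 0; last exact: C.
  by apply: C'; apply: contraNneq nz => ->; rewrite c0 mulr0 addr0.
- exact: finite_support_comb.
rewrite (fsum_comb _ _ F' F C' C).
have := spanD S (span_comb vq Sw' Sw).
congr commutator_span; rewrite scalerBr.
set x := T u; set y := T w; set z := vq *: T w'.
by rewrite [z - _ + _]addrACA -opprD [z + y]addrC addrA subrK.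
Qed.

Lemma class_sum_delta C : conj_classes C ->
  \sum_(O \in conj_classes) delta C O *: T (m O) = T (m C).
Proof.
move=> CC; rewrite (@fsum_seq _ _ _ [:: C]) => [|//|O|O _].
- by rewrite big_seq1 /delta eqxx scale1r.
- by rewrite inE => /eqP ->.
by rewrite inE /delta => /negPf ->; rewrite scale0r.
Qed.

(** Only minimality of [m O] is known, so the hypothesis compares [w0] with every minimal length
    element of its class. *)
Lemma expansion_delta w0 :
  (forall u, conj_class w0 u -> ell u = class_len (conj_class w0) -> eqT T w0 u) ->
  expansion w0 (delta (conj_class w0)).
Proof.
have CC : conj_classes (conj_class w0) by exists w0.
move=> min; split.
- move=> O; rewrite /delta; have [-> _ //|_] := eqVneq O (conj_class w0).
  by rewrite eqxx.
- apply: (@sub_finite_set _ _ [set conj_class w0]); last exact: finite_set1.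
  by move=> O /=; rewrite /delta; have [->|_] := eqVneq O (conj_class w0); rewrite ?eqxx.
rewrite class_sum_delta //; have [mC lC] := hm CC.
by apply: min => //; rewrite -lC extlenE.
Qed.

Lemma expansion_translation a b :
  expansion (el a b We) (delta (conj_class (el a b We))).
Proof.
apply: expansion_delta => u; have [c [d [x ->]]] := el_surj u.
by move=> /conj_translation_inv[-> [z [-> ->]]] _; apply: eqT_translation.
Qed.

(** The minimal length elements are the six products of two distinct simple reflections. They form
    two cycles under conjugation by [tau], joined by the conjugation of s1 s2 into s2 s1. *)
Lemma expansion_O2 : expansion (el 0 0 W12) (delta class_O2).
Proof.
rewrite class_O2E; apply: expansion_delta => u uC lu.
have {}lu : (ell u <= 2)%N.
  by rewrite lu; have := class_len_le (conj_refl (el 0 0 W12)); rewrite ellE.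
move: uC lu; have [a [b [x ->]]] := el_surj u.
move=> /conj_inv[/= _ rx _ [n E]]; rewrite ellE => lu.
have rot12 c d c' d' : c' = 2 - c - d -> d' = c - 1 ->
    eqT T (el c d W12) (el c' d' W12).
  by move=> -> ->; apply: (eqT_tau_el hT); rewrite tauE !elM; congr el => /=; lia.
have rot21 c d c' d' : c' = 1 - c - d -> d' = c + 1 ->
    eqT T (el c d W21) (el c' d' W21).
  by move=> -> ->; apply: (eqT_tau_el hT); rewrite tauE !elM; congr el => /=; lia.
have sh : eqT T (el 0 0 W12) (el 0 0 W21).
  by apply: (@eqT_shift_el _ _ hT o1); rewrite ?simpleE ?elM ?ellE //=; lia.
have R1 : eqT T (el 0 0 W12) (el 2 (-1) W12) by apply: rot12; lia.
have R2 : eqT T (el 2 (-1) W12) (el 1 1 W12) by apply: rot12; lia.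
have R3 : eqT T (el 0 0 W21) (el 1 1 W21) by apply: rot21; lia.
have R4 : eqT T (el 1 1 W21) (el (-1) 2 W21) by apply: rot21; lia.
case: x rx lu => //= _ lu.
  have [[-> ->]|[[-> ->]|[-> ->]]] : (a = 0 /\ b = 0) \/ (a = 2 /\ b = -1) \/ (a = 1 /\ b = 1).
    by lia.
  - exact: eqT_refl.
  - exact: R1.
  - exact: eqT_trans R1 R2.
have [[-> ->]|[[-> ->]|[-> ->]]] : (a = 0 /\ b = 0) \/ (a = 1 /\ b = 1) \/ (a = -1 /\ b = 2).
  by lia.
- exact: sh.
- exact: eqT_trans sh R3.
- exact: eqT_trans (eqT_trans sh R3) R4.
Qed.

(** Minimal length leaves one value of the parameter for odd [i] and at most two for even [i]; these
    two are exchanged by the swap. *)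
Lemma eqT_reflF_min i k k' : ell (reflF i k) = refl_len i -> ell (reflF i k') = refl_len i ->
  eqT T (reflF i k) (reflF i k').
Proof.
rewrite /reflF !ellE /refl_len /= => lk lk'.
have [<-|ne] := eqVneq k k'; first exact: eqT_refl.
have [rg ->] : ((0 <= i /\ 1 - 2 * i <= k <= i) \/ (i <= 0 /\ i + 1 <= k <= - 2 * i)) /\
    k' = 1 - k - i.
  have := odd_double_half (absz i).
  by move: lk lk'; case: (odd _) => /= lk lk' Eh; lia.
apply: eqT_trans (eqT_reflF_swap hT rg) _.
by apply: (eqT_W1_reflF hT); lia.
Qed.

Lemma expansion_refl i a b x : is_refl x -> refl_index a b x = 3 * i ->
  ell (el a b x) = refl_len i -> expansion (el a b x) (delta (reflC i)).
Proof.
move=> rx E lx; rewrite -(reflCE rx E); apply: expansion_delta => u.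
rewrite (reflCE rx E) class_len_reflC => /reflCP[c [d [y [-> ry Ey]]]] ly.
have [k [Ek lk]] := eqT_reflF hT rx E; have [k' [Ek' lk']] := eqT_reflF hT ry Ey.
apply: eqT_trans Ek _; apply: eqT_trans (eqT_sym Ek').
by apply: eqT_reflF_min; [rewrite lk lx | rewrite lk' ly].
Qed.

Lemma reduce_eqT u y z y' z' u' :
  commutator_span (T u' - (T y + vq *: T z)) ->
  eqT T u u' -> eqT T y y' -> eqT T z z' -> commutator_span (T u - (T y' + vq *: T z')).
Proof.
move=> S Su Sy Sz; have := spanD (spanD Su S) (span_comb vq Sz Sy).
congr commutator_span; rewrite scalerBr.
set a := T u; set b := T u'; set c := T y; set d := vq *: T z.
rewrite [a - b + _]addrA subrK [d - _ + _]addrACA -opprD [d + c]addrC addrA subrK.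
by rewrite [X in _ - X]addrC.
Qed.

Definition domT (k q : int) : extW := el (2 * k - q) (2 * q - k) We.

(** The swap through s0 leads to an element [E] that s1 shortens by two. The product of s1 with [E]
    is a translation, by a coweight in the Weyl orbit of k alpha1 + j alpha2. *)
Lemma reflF_step k j : k < 2 * j -> j < 2 * k ->
  commutator_span (T (reflF (- k) (j + 1)) - (T (reflF (- k) j) + vq *: T (domT k j))).
Proof.
move=> lo hi; pose E := el (k - 2 * j) (- 2 * k + j) W1.
have EE : (simple o1 * E * simple o1)%g = el (2 * j - k) (- k - j) W1.
  by rewrite simpleE /E !elM; congr el => /=; lia.
have EL : (simple o1 * E)%g = el (2 * j - k) (- k - j) We.
  by rewrite simpleE /E !elM; congr el => /=; lia.
have R : commutator_span (T E - (T (simple o1 * E * simple o1)%g + vq *: T (simple o1 * E)%g)).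
  by apply: (eqT_reduce hT); rewrite EE /E !ellE /=; lia.
rewrite EE EL in R; apply: (reduce_eqT R).
- have := @eqT_reflF_swap _ _ hT (- k) (j + 1); rewrite /E.
  have -> : 2 - 2 * (j + 1) - - k = k - 2 * j by lia.
  have -> : 2 * (- k) - 1 + (j + 1) = - 2 * k + j by lia.
  by apply; lia.
- by apply: (eqT_W1_reflF hT); lia.
have := eqT_translation hT (2 * j - k) (- k - j) W12; rewrite /domT /=.
by have -> : - (2 * j - k) - (- k - j) = 2 * k - j by lia.
Qed.

Definition slice (k lo hi : int) : set (set extW) :=
  [set O | exists q : int, [/\ lo <= q, q < hi & O = conj_class (domT k q)]].

(** The coweight k alpha1 + j alpha2 is strictly dominant for k/2 < j < 2k. The smallest such j,
    [k./2.+1], is also a parameter at which [reflF (- k)] has minimal length, so the descent stops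
    there. *)
Lemma expansion_slice k n : (k./2.+1 + n <= 2 * k)%N ->
  expansion (reflF (- k%:Z) (k./2.+1 + n)%N)
    (fun O => vq * indic (slice k k./2.+1 (k./2.+1 + n)%N) O + delta (reflC (- k%:Z)) O).
Proof.
elim: n => [|n IH] le_n.
  have E0 : slice k k./2.+1 (k./2.+1 + 0)%N = set0.
    by apply/seteqP; split=> // O [q []]; lia.
  apply: (@expansion_ext _ (delta (reflC (- k%:Z)))).
    by move=> O; rewrite E0 indic0 mulr0 add0r.
  apply: expansion_refl => //=; first by lia.
  rewrite refl_lenN /refl_len ellE /=.
  by have := odd_double_half k; case: (odd k) => /=; lia.
have [lo hi] : (k < 2 * (k./2.+1 + n))%N /\ (k./2.+1 + n < 2 * k)%N.
  by have := odd_double_half k; case: (odd k) => /=; lia.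
have S := @reflF_step k%:Z (k./2.+1 + n)%N.
have := expansion_step (S _ _) (IH _) (expansion_translation _ _).
rewrite (_ : (k./2.+1 + n)%N%:Z + 1 = (k./2.+1 + n.+1)%N); last by lia.
move=> X; apply: expansion_ext (X _ _ _) => [O|||]; [|lia..].
set C := conj_class _.
have -> : slice k k./2.+1 (k./2.+1 + n.+1)%N = C |` slice k k./2.+1 (k./2.+1 + n)%N.
  apply/seteqP; split=> [O' [q [q1 q2 ->]]|O' [->|[q [q1 q2 ->]]]].
  - have [->|ne] := eqVneq q (k./2.+1 + n)%N; first by left.
    by right; exists q; split=> //; lia.
  - by exists (k./2.+1 + n)%N; split=> //; lia.
  - by exists q; split=> //; lia.
rewrite indic1; first by rewrite mulrDr addrA.
by move=> [q [q1 q2]] /dominant_class_inj[]; lia.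
Qed.

End Expansion.

(** * The index sets of the statement *)

Lemma class_invariants a b x c d y : conj_class (el a b x) = conj_class (el c d y) ->
  [/\ is_refl x = is_refl y, is_rot x = is_rot y & refl_index a b x = refl_index c d y].
Proof.
move=> E; have : conj_class (el c d y) (el a b x) by rewrite -E; apply: conj_refl.
by move=> /conj_inv[-> -> -> _].
Qed.

Definition transl_classes (n : int) : set (set extW) :=
  [set O | exists p q : int, [/\ p <= n, q < 2 * p, p < 2 * q & O = conj_class (domT p q)]].

Definition refl_classes (e : int) (n : nat) : set (set extW) :=
  [set O | exists l : nat, [/\ (0 < l)%N, (l <= n)%N & O = reflC (e * l%:Z)]].

Lemma t_root_comb p q : t (root_comb p q) = domT p q.
Proof. by rewrite root_combE tE; congr el; lia. Qed.

Lemma root_comb_inj p q p' q' : root_comb p q = root_comb p' q' -> p = p' /\ q = q'.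
Proof. by rewrite !root_combE => -[]; lia. Qed.

Lemma root_combB p q p' q' : root_comb p q - root_comb p' q' = root_comb (p - p') (q - q').
Proof. by rewrite !root_combE; congr (_, _) => /=; lia. Qed.

(** Among dominant elements, Q_sh removes exactly the two walls. Strict dominance gives q < 2p, so p
    <= n already bounds q, and the bound n (alpha1 + 2 alpha2) lies on a wall, so the inequality is
    strict for free. *)
Lemma classes_belowE n : classes_below (root_comb n (2 * n)) = transl_classes n.
Proof.
apply/seteqP; split=> [O [x [[[p [q ->]] dom [a [b [ab0 Eab]]]] [_ sh]] <-]|O [p [q [pn qp pq ->]]]].
  move: Eab; rewrite root_combB => /root_comb_inj[Ea Eb].
  move: dom; rewrite root_combE => -[/= d1 d2]; rewrite -root_combE t_root_comb.
  exists p, q; split=> //; first by lia.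
  - suff : q <> 2 * p by lia.
    by move=> Eq; apply: sh; exists p; constructor 1; rewrite Eq mulrC.
  - suff : p <> 2 * q by lia.
    by move=> Ep; apply: sh; exists q; constructor 2; rewrite Ep mulrC.
exists (root_comb p q); last by rewrite t_root_comb.
split; last first.
  split; first by exists p, q.
  by move=> [k [] /root_comb_inj[]]; lia.
split; first by exists p, q.
  by rewrite root_combE; split => /=; lia.
exists (absz (n - p)%R), (absz (2 * n - q)%R); rewrite root_combB; split.
  by apply/eqP => -[]; lia.
by congr root_comb; lia.
Qed.

(** The bounding element has index 3n whatever [p] is, and minimal lengths increase strictly with
    the index. *)
Lemma classes_C_leE p n : classes_C_le (root_comb p n%:Z) = refl_classes 1 n.
Proof.
have len_n : class_len (conj_class (t (root_comb p n%:Z) * s1)%g) = refl_len n.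
  by rewrite t_root_comb s1E elM (@reflCE n%:Z) ?class_len_reflC //=; lia.
have len_i i : class_len (class_C i) = refl_len i by rewrite class_CE class_len_reflC.
apply/seteqP; split=> [O [i [i0 ->]]|O [i [i0 le_i ->]]].
  by rewrite len_n len_i refl_len_mono => le_i; exists i; rewrite class_CE mul1r.
by exists i; rewrite mul1r -class_CE len_n len_i refl_len_mono.
Qed.

Lemma classes_C'_leE n q : classes_C'_le (root_comb n%:Z q) = refl_classes (-1) n.
Proof.
have len_n : class_len (conj_class (t (root_comb n%:Z q) * s2)%g) = refl_len n.
  by rewrite t_root_comb s2E elM (@reflCE (- n%:Z)) ?class_len_reflC ?refl_lenN //=; lia.
have len_i i : class_len (class_C' i) = refl_len i.
  by rewrite class_C'E class_len_reflC refl_lenN.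
apply/seteqP; split=> [O [i [i0 ->]]|O [i [i0 le_i ->]]].
  by rewrite len_n len_i refl_len_mono => le_i; exists i; rewrite class_C'E mulN1r.
by exists i; rewrite class_C'E mulN1r -class_C'E len_n len_i refl_len_mono.
Qed.

(* [cpoly n i j] is [(v - v^-1)^2] on the [O_lambda] with [lambda] in
   [Q_{n (alpha1 + 2 alpha2)}], [v - v^-1] on [C_1, ..., C_i] and [C'_1, ..., C'_j],
   and [1] on [O_2]. *)
Definition cpoly (n : int) (i j : nat) (O : set extW) : laurent :=
  vq ^+ 2 * indic (transl_classes n) O + vq * indic (refl_classes 1 i) O
  + vq * indic (refl_classes (-1) j) O + delta class_O2 O.

Lemma indicT (S : set (set extW)) O : S O -> indic S O = 1.
Proof. by move=> SO; rewrite /indic mem_set. Qed.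

Lemma indicF (S : set (set extW)) O : ~ S O -> indic S O = 0.
Proof. by move=> SO; rewrite /indic memNset. Qed.

(** The families are pairwise disjoint by the conjugacy invariants, so the nested conditional is a
    sum, the form in which each reduction step adds one term. *)
Lemma cpoly_if n i j O :
  (if O \in transl_classes n then (v - vinv) ^+ 2
   else if O \in refl_classes 1 i `|` refl_classes (-1) j then v - vinv
   else if O == class_O2 then 1 else 0) = cpoly n i j O.
Proof.
rewrite /cpoly -/vq; case: ifPn => [/set_mem On|/negP nOn].
  rewrite (indicT On); have [p [q [_ _ _ OE]]] := On.
  rewrite !indicF ?/delta; first last.
  - by move=> [l [l0 _]]; rewrite OE => /class_invariants[].
  - by move=> [l [l0 _]]; rewrite OE => /class_invariants[].
  have -> : (O == class_O2) = false.
    by apply/eqP; rewrite OE class_O2E => /class_invariants[].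
  by rewrite mulr1 !mulr0 !addr0.
rewrite (indicF (S := transl_classes n)); last by move=> On; apply: nOn; apply: mem_set.
rewrite mulr0 add0r; case: ifPn => [/set_mem [] Oi|/negP nO].
- rewrite (indicT Oi); have [l [l0 _ OE]] := Oi.
  rewrite indicF; last by move=> [l' [l0' _]]; rewrite OE => /reflC_inj; lia.
  have E : (O == class_O2) = false.
    by apply/eqP; rewrite OE class_O2E => /class_invariants[].
  by rewrite /delta E mulr1 mulr0 !addr0.
- rewrite (indicT Oi); have [l [l0 _ OE]] := Oi.
  rewrite indicF; last by move=> [l' [l0' _]]; rewrite OE => /reflC_inj; lia.
  have E : (O == class_O2) = false.
    by apply/eqP; rewrite OE class_O2E => /class_invariants[].
  by rewrite /delta E mulr1 mulr0 add0r addr0.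
rewrite (indicF (S := refl_classes 1 i)); last first.
  by move=> Oi; apply: nO; apply: mem_set; left.
rewrite indicF; last by move=> Oi; apply: nO; apply: mem_set; right.
by rewrite mulr0 !add0r /delta; case: eqP.
Qed.

Lemma refl_classesS e i : refl_classes e i.+1 = reflC (e * i.+1%:Z) |` refl_classes e i.
Proof.
apply/seteqP; split=> [O [l [l0 le_l ->]]|O [->|[l [l0 le_l ->]]]].
- have [->|ne] := eqVneq l i.+1; first by left.
  by right; exists l; split=> //; lia.
- by exists i.+1.
- by exists l; split=> //; lia.
Qed.

Lemma indic_reflS e i O : e != 0 ->
  indic (refl_classes e i.+1) O = delta (reflC (e * i.+1%:Z)) O + indic (refl_classes e i) O.
Proof.
move=> e0; rewrite refl_classesS indic1 // => -[l [l0 le_l /reflC_inj /mulfI]].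
by move=> /(_ e0); lia.
Qed.

Lemma transl_classesS (n : nat) O :
  indic (transl_classes n.+1%:Z) O =
  indic (slice n.+1%:Z n.+1./2.+1%:Z (2 * n.+1)%N%:Z) O + indic (transl_classes n%:Z) O.
Proof.
have -> : transl_classes n.+1%:Z =
    slice n.+1%:Z n.+1./2.+1%:Z (2 * n.+1)%N%:Z `|` transl_classes n%:Z.
  apply/seteqP; split=> [O' [p [q [pn qp pq ->]]]|O' [[q [lo hi ->]]|[p [q [pn qp pq ->]]]]].
  - have [Ep|ne] := eqVneq p n.+1%:Z; last by right; exists p, q; split=> //; lia.
    left; exists q; rewrite -Ep; split=> //; last by lia.
    by have := odd_double_half n.+1; case: (odd _) => /=; lia.
  - by exists n.+1%:Z, q; split=> //; lia.
  - by exists p, q; split=> //; lia.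
have disj : slice n.+1%:Z n.+1./2.+1%:Z (2 * n.+1)%N%:Z O -> ~ transl_classes n%:Z O.
  move=> [q [lo hi ->]] [p' [q' [pn qp pq]]] /dominant_class_inj.
  by move: lo; have := odd_double_half n.+1; case: (odd _) => /=; lia.
have [On|nO] := pselect (transl_classes n%:Z O).
  rewrite [LHS]indicT; last by right.
  rewrite (indicF (S := slice _ _ _)); last by move=> /disj.
  by rewrite indicT ?add0r.
rewrite [X in _ + X]indicF // addr0.
have [Os|nOs] := pselect (slice n.+1%:Z n.+1./2.+1%:Z (2 * n.+1)%N%:Z O).
  by rewrite !indicT //; left.
by rewrite !indicF // => -[].
Qed.

(** * Induction along the chain *)

Section Main.
Variables (H : algType laurent) (T : extW -> H) (m : set extW -> extW).
Hypotheses (hT : is_hecke_algebra T) (hm : min_length_rep m).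

Local Notation expansion := (cocenter_expansion T m).

Let reduce_el i a b x c d y c' d' y' :
  (simple i * el a b x * simple i)%g = el c d y -> (simple i * el a b x)%g = el c' d' y' ->
  len a b x = (len c d y).+2 ->
  commutator_span (T (el a b x) - (T (el c d y) + vq *: T (el c' d' y'))).
Proof.
by move=> E E' L; rewrite -E -E'; apply: (eqT_reduce hT); rewrite E !ellE.
Qed.

Lemma expansion_B (n : nat) : expansion (el 0 (3 * n%:Z) W12) (cpoly n%:Z (2 * n).-1 n) ->
  expansion (el 0 (3 * n.+1%:Z) W21) (cpoly n%:Z (2 * n).+1 n).
Proof.
move=> A.
have S0 : commutator_span (T (el 0 (3 * n.+1%:Z) W21) -
    (T (el (- (3 * n%:Z)) 0 W12) + vq *: T (el (- (3 * n%:Z) - 2) 1 W2))).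
  by apply: (@reduce_el o0); rewrite ?simpleE ?elM /=; [congr el; lia | congr el; lia | lia].
have X1 : expansion (el (- (3 * n%:Z) - 2) 1 W2) (delta (reflC (2 * n).+1)).
  apply: (expansion_refl hT hm) => //=; first by lia.
  by rewrite ellE /refl_len /= oddM /=; lia.
suff X0 : expansion (el (- (3 * n%:Z)) 0 W12) (cpoly n%:Z (2 * n) n).
  apply: expansion_ext (expansion_step S0 X0 X1) => O.
  by rewrite /cpoly (indic_reflS (2 * n)) // mul1r; ring.
case: n A {S0 X1} => [|n] A; first exact: A.
have S1 : eqT T (el (- (3 * n.+1%:Z)) 0 W12) (el (3 * n.+1%:Z) (- (3 * n.+1%:Z)) W21).
  by apply: (@eqT_shift_el _ _ hT o1); rewrite ?simpleE ?elM ?ellE /=; [congr el; lia | lia | lia].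
have S2 : commutator_span (T (el (3 * n.+1%:Z) (- (3 * n.+1%:Z)) W21) -
    (T (el 0 (3 * n.+1%:Z) W12) + vq *: T (el 0 (3 * n.+1%:Z) W1))).
  by apply: (@reduce_el o2); rewrite ?simpleE ?elM /=; [congr el; lia | congr el; lia | lia].
have X2 : expansion (el 0 (3 * n.+1%:Z) W1) (delta (reflC (2 * n.+1)%N)).
  apply: (expansion_refl hT hm) => //=; first by lia.
  by rewrite ellE /refl_len absz_nat oddM /=; lia.
apply: (expansion_eqT S1); apply: expansion_ext (expansion_step S2 A X2) => O.
rewrite /cpoly (_ : (2 * n.+1)%N = (2 * n.+1).-1.+1); last by lia.
by rewrite (indic_reflS (2 * n.+1).-1) // mul1r; ring.
Qed.

Lemma expansion_A (n : nat) : expansion (el 0 (3 * n.+1%:Z) W21) (cpoly n%:Z (2 * n).+1 n) ->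
  expansion (el 0 (3 * n.+1%:Z) W12) (cpoly n.+1%:Z (2 * n).+1 n.+1).
Proof.
move=> B.
have S : commutator_span (T (el 0 (3 * n.+1%:Z) W12) -
    (T (el 0 (3 * n.+1%:Z) W21) + vq *: T (el 0 (3 * n.+1%:Z) W2))).
  by apply: (@reduce_el o1); rewrite ?simpleE ?elM /=; [congr el; lia | congr el; lia | lia].
have half_le : (n.+1./2.+1 <= 2 * n.+1)%N.
  by have := odd_double_half n.+1; case: (odd _) => /=; lia.
(* The top parameter [2 * n.+1] is that of t^((n+1)(alpha1 + 2 alpha2)) s2, so its slice contains
   every strictly dominant coweight with alpha1-coefficient n+1. *)
have := @expansion_slice _ _ _ hT hm n.+1 (2 * n.+1 - n.+1./2.+1).
rewrite (subnKC half_le) => /(_ (leqnn _)) X.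
have E : reflF (- n.+1%:Z) (2 * n.+1)%N = el 0 (3 * n.+1%:Z) W2.
  by rewrite /reflF; congr el; lia.
rewrite E in X; apply: expansion_ext (expansion_step S B X) => O.
by rewrite /cpoly transl_classesS (indic_reflS n) // mulN1r; ring.
Qed.

(** At [n = 0] the predecessor truncates to 0, which is what the start needs: [cpoly 0 0 0] is
    supported on O_2 alone, as is the expansion of s1 s2. *)
Lemma expansion_AB (n : nat) :
  expansion (el 0 (3 * n%:Z) W12) (cpoly n%:Z (2 * n).-1 n) /\
  expansion (el 0 (3 * n.+1%:Z) W21) (cpoly n%:Z (2 * n).+1 n).
Proof.
have AB k : expansion (el 0 (3 * k%:Z) W12) (cpoly k%:Z (2 * k).-1 k) ->
  expansion (el 0 (3 * k%:Z) W12) (cpoly k%:Z (2 * k).-1 k) /\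
  expansion (el 0 (3 * k.+1%:Z) W21) (cpoly k%:Z (2 * k).+1 k).
  by move=> A; split=> //; apply: expansion_B.
elim: n => [|n [_ /expansion_A A]]; apply: AB; last first.
  by rewrite (_ : (2 * n.+1).-1 = (2 * n).+1) //; lia.
apply: (expansion_ext _ (expansion_O2 hT hm)) => O.
rewrite /cpoly !indicF ?mulr0 ?add0r //.
- by move=> [l []]; lia.
- by move=> [l []]; lia.
- by move=> [p [q []]]; lia.
Qed.
End Main.

Theorem proposition2p8 (H : algType laurent) (T : extW -> H)
    (hT : is_hecke_algebra T)
    (m : set extW -> extW) (hm : min_length_rep m)
    (k : nat) (hk : (0 < k)%N) :
  (forall O : set extW, conj_classes O ->
     class_poly T m (t (root_comb k%:Z (2 * k%:Z)) * s2 * s1)%g O =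
       if O \in classes_below (root_comb (k%:Z - 1) (2 * k%:Z - 2))
         then (v - vinv) ^+ 2
       else if O \in classes_C_le (root_comb k%:Z (2 * k%:Z - 1))
                 `|` classes_C'_le (root_comb (k%:Z - 1) (2 * k%:Z - 2))
         then v - vinv
       else if O == class_O2 then 1
       else 0) /\
  (forall O : set extW, conj_classes O ->
     class_poly T m (t (root_comb k%:Z (2 * k%:Z)) * s1 * s2)%g O =
       if O \in classes_below (root_comb k%:Z (2 * k%:Z))
         then (v - vinv) ^+ 2
       else if O \in classes_C_le (root_comb k%:Z (2 * k%:Z - 1))
                 `|` classes_C'_le (root_comb k%:Z (2 * k%:Z))
         then v - vinv
       else if O == class_O2 then 1
       else 0).
Proof.
case: k hk => [//|n] _.
have E1 : n.+1%:Z - 1 = n%:Z by lia.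
have E2 : 2 * n.+1%:Z - 2 = 2 * n%:Z by lia.
have E3 : 2 * n.+1%:Z - 1 = (2 * n).+1%:Z by lia.
rewrite E1 E2 E3 !classes_belowE !classes_C_leE !classes_C'_leE.
have wE : t (root_comb n.+1%:Z (2 * n.+1%:Z)) = el 0 (3 * n.+1%:Z) We.
  by rewrite t_root_comb; congr el; lia.
split=> O _; rewrite cpoly_if; congr (_ O); apply: (class_polyE hm hT).
  have := (expansion_AB hT hm n).2; congr cocenter_expansion.
  by rewrite wE s1E s2E !elM; congr el => /=; lia.
have := (expansion_AB hT hm n.+1).1; rewrite (_ : (2 * n.+1).-1 = (2 * n).+1); last by lia.
congr cocenter_expansion.
by rewrite wE s1E s2E !elM; congr el => /=; lia.
Qed.
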